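(* Let $d\le n$ and $k\le n$ be positive integers, $\bm a_1,\dots,\bm a_n\in\mathbb{R}^d$, $\lambda>0$, and $\tilde k:=\min\{k,d\}$. Let $$z_k:=\min_{S\subseteq [n]}\left\{\operatorname{tr}\left(\left(\sum_{i\in S}\bm a_i\bm a_i^{\top}+\lambda \bm I_d\right)^{-1}\right): |S|=k\right\},$$ $$\nu_k^{\mathrm N}:=\min_{\bm x\in[0,1]^n}\left\{\operatorname{conv}\Gamma\left(\sum_{i\in[n]}x_i\bm a_i\bm a_i^{\top};\lambda\right)+\frac{d-\tilde k}{\lambda}: \sum_{i\in[n]}x_i=k\right\},$$ with $\operatorname{conv}\Gamma$ as defined in the context. Then $$1\le\frac{z_k}{\nu_k^{\mathrm N}}\le\min\left\{\frac{d-1}{d-k},\,n-k+1\right\}\quad\text{for all }k\in[d-1],$$ $$1\le\frac{z_k}{\nu_k^{\mathrm N}}\le\min\{d,\,n-d+1\}\quad\text{if }k=d,$$ $$1\le\frac{z_k}{\nu_k^{\mathrm N}}\le\frac{n-d+1}{k-d+1}\quad\text{for all }k\in[d+1,n].$$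
   Context: $[n]=\{1,\dots,n\}$ and $[s,n]=\{s,\dots,n\}$; the constraint $\bm x\in[0,1]^n$ uses the real unit interval. $\mathcal S_+^d$ is the set of $d\times d$ symmetric positive semidefinite matrices. For $\bm X\in\mathcal S_+^d$ with eigenvalues $\sigma_1\ge\cdots\ge\sigma_d\ge0$, $\Gamma(\bm X;\lambda):=\sum_{i\in[\tilde k]}\frac1{\sigma_i+\lambda}$. The function $\operatorname{conv}\Gamma(\cdot;\lambda)$ is the convex envelope (largest convex underestimator) of $\Gamma(\cdot;\lambda)$ on $\mathcal S_+^d$; explicitly, $$\operatorname{conv}\Gamma(\bm X;\lambda)=\sum_{i\in[\eta]}\frac1{\sigma_i+\lambda}+\frac{(\tilde k-\eta)^2}{\sum_{i\in[\eta+1,d]}\sigma_i+(\tilde k-\eta)\lambda},$$ where $0\le\eta\le\tilde k-1$ is the unique integer with $\sigma_\eta>\frac1{\tilde k-\eta}\sum_{i\in[\eta+1,d]}\sigma_i\ge\sigma_{\eta+1}$, with $\sigma_0=\infty$. *)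

(* Defs.v *)
From HB Require Import structures.
From mathcomp Require Import all_boot all_order all_algebra.
From mathcomp Require Import all_classical all_reals all_analysis.
Set Implicit Arguments.
Unset Strict Implicit.
Unset Printing Implicit Defensive.
Import Order.TTheory GRing.Theory Num.Theory.
Local Open Scope classical_set_scope.
Local Open Scope ring_scope.

Definition psd (R : realType) (d : nat) : set 'M[R]_d :=
  [set X | X^T = X /\ forall v : 'cV[R]_d, 0 <= (v^T *m X *m v) 0 0].

(* Eigenvalues counted with multiplicity, in nonincreasing order: sigma_(i+1)
   is (eigenvalues X)`_i. The sequence exists and is unique when X is real
   symmetric; the junk value [::] is used when char_poly X does not split. *)
Definition eigenvalues (R : realType) (d : nat) (X : 'M[R]_d) : seq R :=
  xget [::] [set s : seq R | sorted >=%R s /\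
                             char_poly X = \prod_(u <- s) ('X - u%:P)].

Definition Gamma (R : realType) (d m : nat) (lambda : R) (X : 'M[R]_d) : R :=
  \sum_(i < m) ((eigenvalues X)`_i + lambda)^-1.

(* Pointwise supremum of the convex underestimators of f on D, itself the
   largest one. The supremum is over a nonempty set bounded by f X as soon as
   X is in D and f has some convex underestimator; for Gamma with lambda > 0
   on the cone psd, the zero function is one. *)
Definition convex_envelope (R : realType) (d : nat) (D : set 'M[R]_d)
    (f : 'M[R]_d -> R) (X : 'M[R]_d) : R :=
  sup [set g X | g in [set g : 'M[R]_d -> R |
    convex_function D g /\ forall Y, D Y -> g Y <= f Y]].

Definition conv_Gamma (R : realType) (d m : nat) (lambda : R) (X : 'M[R]_d) : R :=
  convex_envelope (@psd R d) (Gamma m lambda) X.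

Definition z_values (R : realType) (d n k : nat) (a : 'I_n -> 'cV[R]_d)
    (lambda : R) : set R :=
  [set \tr (invmx (\sum_(i in S) a i *m (a i)^T + lambda%:M)) |
     S in [set S : {set 'I_n} | #|S| = k]].

Definition nu_values (R : realType) (d n k : nat) (a : 'I_n -> 'cV[R]_d)
    (lambda : R) : set R :=
  [set conv_Gamma (minn k d) lambda (\sum_i x 0 i *: (a i *m (a i)^T))
       + (d%:R - (minn k d)%:R) / lambda |
     x in [set x : 'rV[R]_n | (forall i, 0 <= x 0 i <= 1) /\
                              \sum_i x 0 i = k%:R]].

Definition is_min (R : realType) (A : set R) (m : R) : Prop :=
  A m /\ lbound A m.

(* Main.v *)
Require Import Defs.
From HB Require Import structures.
From mathcomp Require Import all_boot all_order all_algebra.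
From mathcomp Require Import all_classical all_reals all_analysis.
From mathcomp Require Import fingroup perm complex ring lra zify.
Set Implicit Arguments.
Unset Strict Implicit.
Unset Printing Implicit Defensive.
Import Order.TTheory GRing.Theory Num.Theory numFieldNormedType.Exports.
Local Open Scope classical_set_scope.
Local Open Scope ring_scope.

(* Put f(X) = tr (X + lambda I)^-1, A_S = sum_(i in S) a_i a_i^T,
   A(x) = sum_i x_i a_i a_i^T and m = min (k, d).

   The envelope of Gamma is only ever bounded by exhibiting convex minorants:
   f - (d - m) / lambda, the tangent X |-> m (2 u - u^2 lambda) - u^2 tr X, and
   transforms of a given minorant showing that the envelope is antitone and
   Lipschitz on the cone, so that nu is attained. For |S| = k the matrix A_S has
   rank at most k, whence Gamma(A_S) + (d - m) / lambda = f(A_S) and nu <= z;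
   conversely nu >= f(A_[n]) and nu >= (d - k) / lambda.

   Removing one element of S, |S| = t > d, chosen by averaging with weights
   1 - leverage, multiplies f by at most (t - d + 1) / (t - d). Telescoping from
   [n] gives (k - d + 1) z <= (n - d + 1) nu for k >= d. For k < d one goes down
   to d elements and then drops d - k more, each costing at most 1 / lambda:
   z <= (n - d + 1) nu + (d - k) / lambda <= (n - d + 2) nu <= (n - k + 1) nu.
   The bound (d - 1) / (d - k) compares any S containing the longest a_i,
   f(A_S) <= (d - 1) / lambda + u with u = 1 / (max |a_i|^2 + lambda), with the
   tangent bound nu >= (d - k) / lambda + k u.

   The factor d for k = d comes from averaging over all d-tuples g of indices
   with weight x^g. Let p_M = det (X I + M) and let A_g be the Gram sum of g.
   Then sum_g x^g p_(A_g) has i-th coefficient (d! / i!) d^i times that of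
   p_(A(x)), because adding a random rank-one term acts on t |-> det (M + t A(x))
   as sum_i x_i + d/dt. On the other hand each g satisfies
   z (p_0 + (lambda / d) p_1) <= p_1 + 2 (lambda / d) p_2: if g is injective this
   follows from z <= f(A_g) = p'(lambda) / p(lambda), and otherwise p_0 = 0 and
   z lambda <= d. *)

(** * The real spectral theorem *)
(** Over [R[i]] the matrix is Hermitian, hence unitarily diagonalizable with real diagonal; the
    first diagonal entry is an eigenvalue there, and this descends to [R]. *)
Lemma symmetric_eigenvalue (R : rcfType) (n : nat) (A : 'M[R]_n.+1) :
  A^T = A -> exists a : R, eigenvalue A a.
Proof.
move=> symA; pose f : {rmorphism R -> R[i]} := real_complex R.
pose B := map_mx f A.
have Bherm : B \is hermsymmx.
  apply/is_hermitianmxP; rewrite expr0 scale1r /B map_trmx.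
  apply/matrixP => i j; rewrite !mxE /= -[in LHS]symA mxE.
  by symmetry; apply/CrealP; rewrite complex_real.
have /hermitian_normalmx /orthomx_spectralP := Bherm.
have := hermitian_spectral_diag_real Bherm.
have := spectral_unit B.
set P := spectralmx B; set s := spectral_diag B => Pu sreal Beq.
have PB : P *m B = diag_mx s *m P by rewrite [in LHS]Beq !mulmxA mulmxV // mul1mx.
have [a sa] : exists a, s 0 0 = f a.
  by exists (complex.Re (s 0 0)); move/mxOverP: sreal => /(_ 0 0) /RRe_real /esym.
exists a; rewrite -(eigenvalue_map f) -/B; apply/eigenvalueP.
exists (row 0 P).
  by rewrite -row_mul PB row_mul row_diag_mx -scalemxAl -rowE sa.
apply/eqP => rP0; have : row_free P by rewrite row_free_unit.
move=> /row_freeP [Q PQ].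
have : row 0 P *m Q = 0 by rewrite rP0 mul0mx.
rewrite -row_mul PQ => /rowP /(_ 0); rewrite !mxE eqxx => /eqP.
by rewrite oner_eq0.
Qed.

Lemma dot_ge0 (R : realDomainType) (n : nat) (w : 'rV[R]_n) : 0 <= (w *m w^T) 0 0.
Proof. by rewrite mxE sumr_ge0 // => i _; rewrite mxE -expr2 sqr_ge0. Qed.

Lemma dot_eq0 (R : realDomainType) (n : nat) (w : 'rV[R]_n) :
  ((w *m w^T) 0 0 == 0) = (w == 0).
Proof.
apply/eqP/eqP => [|->]; last by rewrite mul0mx mxE.
rewrite mxE => /eqP; rewrite psumr_eq0; last first.
  by move=> i _; rewrite mxE -expr2 sqr_ge0.
move=> /allP w0; apply/rowP => i; rewrite mxE.
by have := w0 i (mem_index_enum _); rewrite mxE /= mulf_eq0 orbb => /eqP.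
Qed.

(* The Householder reflection exchanging [v] and the first basis vector. *)
Lemma orthonormal_first_row (R : rcfType) (n : nat) (v : 'rV[R]_n.+1) :
  v *m v^T = 1%:M ->
  exists H : 'M[R]_n.+1, [/\ H^T = H, H *m H = 1%:M & row 0 H = v].
Proof.
move=> vv; pose e : 'rV[R]_n.+1 := delta_mx 0 0; pose w := v - e.
have ee : e *m e^T = 1%:M.
  by apply/matrixP => i j; rewrite !ord1 trmx_delta mul_delta_mx !mxE !eqxx.
have evE : v *m e^T = (v 0 0)%:M.
  by rewrite trmx_delta -colE; apply/matrixP => i j; rewrite !ord1 !mxE eqxx.
have veE : e *m v^T = (v 0 0)%:M.
  by rewrite -rowE; apply/matrixP => i j; rewrite !ord1 !mxE eqxx.
have ewE : e *m w^T = (v 0 0 - 1)%:M.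
  by rewrite linearB /= mulmxBr veE ee raddfB.
have wwE : w *m w^T = (2 - 2 * v 0 0)%:M.
  rewrite linearB /= mulmxBr !mulmxBl vv ee evE veE -!raddfB /=.
  by congr (_%:M); ring.
have [w0|w0] := eqVneq w 0.
  exists 1%:M; rewrite trmx1 mulmx1; split=> //.
  rewrite rowE mulmx1; apply/esym/eqP; rewrite -subr_eq0; exact/eqP.
have nz : 2 - 2 * v 0 0 != 0.
  have := w0; rewrite -dot_eq0 wwE mxE eqxx mulr1n; apply.
(* By [wwE] this is 2 / |w|^2, the Householder coefficient. *)
pose c := 2 / (2 - 2 * v 0 0).
exists (1%:M - c *: (w^T *m w)); split.
- by rewrite linearB /= trmx1 linearZ /= trmx_mul trmxK.
- set K := w^T *m w.
  have KK : K *m K = (2 - 2 * v 0 0) *: K.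
    by rewrite /K mulmxA -(mulmxA _ w) wwE mul_mx_scalar -scalemxAl.
  rewrite mulmxBr mulmx1 mulmxBl mul1mx -scalemxAl -scalemxAr KK !scalerA.
  rewrite -addrA -opprD -scalerBl -scalerDl.
  have -> : c + (c - c * c * (2 - 2 * v 0 0)) = 0 by rewrite /c; field.
  by rewrite scale0r subr0.
- rewrite rowE mulmxBr mulmx1 -scalemxAr mulmxA -/e ewE mul_scalar_mx scalerA.
  have -> : c * (v 0 0 - 1) = -1 by rewrite /c; field.
  by rewrite scaleN1r opprK /w addrC subrK.
Qed.

(** A unit eigenvector becomes the first row of the orthogonal [H]; in that basis symmetry splits
    off a 1 x 1 block and induction diagonalizes the rest. The rows of [U] are eigenvectors. *)
Lemma real_spectral (R : rcfType) (n : nat) (A : 'M[R]_n) :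
  A^T = A -> exists (U : 'M[R]_n) (s : 'rV[R]_n),
    U *m U^T = 1%:M /\ A = U^T *m diag_mx s *m U.
Proof.
elim: n A => [|n IHn] A symA.
  by exists 0, 0; split; apply/matrixP => [[]].
have [a /eigenvalueP [v0 v0A nz0]] := symmetric_eigenvalue symA.
pose q := (v0 *m v0^T) 0 0.
have q_gt0 : 0 < q by rewrite lt_def dot_ge0 dot_eq0 nz0.
pose v := (Num.sqrt q)^-1 *: v0.
have vA : v *m A = a *: v by rewrite -scalemxAl v0A !scalerA mulrC.
have vv : v *m v^T = 1%:M.
  rewrite linearZ /= -scalemxAl -scalemxAr scalerA [v0 *m _]mx11_scalar -/q.
  rewrite -invfM -expr2 sqr_sqrtr ?ltW // -mul_scalar_mx -scalar_mxM.
  by rewrite mulVf ?gt_eqF.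
have [H [Hsym HH Hv]] := orthonormal_first_row vv.
have [B eB] : exists B : 'M[R]_(1 + n), B = H *m A *m H by exists (H *m A *m H).
have symB : B^T = B by rewrite eB !trmx_mul Hsym symA mulmxA.
have row0B : row 0 B = a *: delta_mx 0 0.
  by rewrite eB !row_mul Hv vA -scalemxAl -Hv rowE -mulmxA HH mulmx1.
have Bul : ulsubmx B = a%:M.
  apply/matrixP => i j; rewrite !ord1 !mxE eqxx.
  have /rowP /(_ 0) := row0B; rewrite !mxE eqxx mulr1 => <-.
  by congr fun_of_matrix; apply/val_inj.
have Bur : ursubmx B = 0.
  apply/matrixP => i j; rewrite !ord1 !mxE.
  have /rowP /(_ (rshift 1 j)) := row0B; rewrite !mxE /= mulr0 => <-.
  by congr fun_of_matrix; apply/val_inj.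
have Bdl : dlsubmx B = 0.
  by rewrite -[dlsubmx B]trmxK trmx_dlsub symB Bur trmx0.
have [|V [s [VV Beq]]] := IHn (drsubmx B).
  by rewrite trmx_drsub symB.
pose K : 'M[R]_(1 + n) := block_mx 1%:M 0 0 V.
have KT : K^T = block_mx 1%:M 0 0 V^T by rewrite tr_block_mx !trmx0 trmx1.
have KK : K *m K^T = 1%:M.
  rewrite KT mulmx_block !mulmx0 !mul0mx !addr0 !add0r mulmx1 VV.
  by rewrite -scalar_mx_block.
pose t : 'rV[R]_(1 + n) := row_mx a%:M s.
have BE : B = K^T *m diag_mx t *m K.
  rewrite -[LHS]submxK Bul Bur Bdl Beq diag_mx_row KT !mulmx_block.
  rewrite !mulmx0 !mul0mx !addr0 !add0r !mul0mx mul1mx mulmx1.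
  by congr block_mx; apply/matrixP => i j; rewrite !ord1 !mxE eqxx.
exists (K *m H), t; split.
  by rewrite trmx_mul Hsym mulmxA -[_ *m H *m H]mulmxA HH mulmx1.
have -> : A = H *m B *m H.
  by rewrite eB !mulmxA HH mul1mx -mulmxA HH mulmx1.
by rewrite trmx_mul Hsym BE !mulmxA.
Qed.

(** * Quadratic forms and ordered eigenvalues *)

Definition quad (R : realType) (d : nat) (X : 'M[R]_d) (v : 'cV[R]_d) : R :=
  (v^T *m X *m v) 0 0.

Definition sqnorm (R : realType) (d : nat) (v : 'cV[R]_d) : R := (v^T *m v) 0 0.

Lemma sqnormE (R : realType) (d : nat) (v : 'cV[R]_d) :
  sqnorm v = \sum_i v i 0 ^+ 2.
Proof. by rewrite /sqnorm mxE; apply: eq_bigr => i _; rewrite mxE expr2. Qed.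

Lemma sqnorm_ge0 (R : realType) (d : nat) (v : 'cV[R]_d) : 0 <= sqnorm v.
Proof. by rewrite sqnormE sumr_ge0 // => i _; rewrite sqr_ge0. Qed.

Lemma sqnorm_eq0 (R : realType) (d : nat) (v : 'cV[R]_d) :
  (sqnorm v == 0) = (v == 0).
Proof. by rewrite /sqnorm -[v in _ *m v]trmxK dot_eq0 trmx_eq0. Qed.

Lemma sqnorm_gt0 (R : realType) (d : nat) (v : 'cV[R]_d) :
  v != 0 -> 0 < sqnorm v.
Proof. by move=> v0; rewrite lt_def sqnorm_eq0 v0 sqnorm_ge0. Qed.

Lemma quad_conj (R : realType) (d : nat) (X C : 'M[R]_d) (v : 'cV[R]_d) :
  quad (C *m X *m C^T) v = quad X (C^T *m v).
Proof. by rewrite /quad trmx_mul trmxK !mulmxA. Qed.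

Lemma quad_diag (R : realType) (d : nat) (s : 'rV[R]_d) (v : 'cV[R]_d) :
  quad (diag_mx s) v = \sum_i s 0 i * v i 0 ^+ 2.
Proof.
rewrite /quad mul_mx_diag mxE; apply: eq_bigr => i _.
by rewrite !mxE; ring.
Qed.

Lemma quadD (R : realType) (d : nat) (X Y : 'M[R]_d) (v : 'cV[R]_d) :
  quad (X + Y) v = quad X v + quad Y v.
Proof. by rewrite /quad mulmxDr mulmxDl mxE. Qed.

Lemma quadZ (R : realType) (d : nat) (c : R) (X : 'M[R]_d) (v : 'cV[R]_d) :
  quad (c *: X) v = c * quad X v.
Proof. by rewrite /quad -scalemxAr -scalemxAl mxE. Qed.

Lemma quad_scalar (R : realType) (d : nat) (c : R) (v : 'cV[R]_d) :
  quad c%:M v = c * sqnorm v.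
Proof. by rewrite /quad mul_mx_scalar -scalemxAl mxE. Qed.

Lemma sqnorm_orth (R : realType) (d : nat) (U : 'M[R]_d) (v : 'cV[R]_d) :
  U^T *m U = 1%:M -> sqnorm (U *m v) = sqnorm v.
Proof. by move=> UU; rewrite /sqnorm trmx_mul mulmxA -(mulmxA _ U^T) UU mulmx1. Qed.

Lemma char_poly_spectral (R : realType) (d : nat) (U : 'M[R]_d) (s : 'rV[R]_d) :
  U *m U^T = 1%:M ->
  char_poly (U^T *m diag_mx s *m U) = \prod_(i < d) ('X - (s 0 i)%:P).
Proof.
move=> UU; have UU' := mulmx1C UU.
have -> : char_poly (U^T *m diag_mx s *m U) = char_poly (diag_mx s).
  rewrite /char_poly /char_poly_mx.
  have -> : 'X%:M - map_mx polyC (U^T *m diag_mx s *m U) =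
            map_mx polyC U^T *m ('X%:M - map_mx polyC (diag_mx s)) *m map_mx polyC U.
    rewrite mulmxBr mulmxBl -!map_mxM mul_mx_scalar -scalemxAl -map_mxM UU'.
    by rewrite map_mx1 scalemx1.
  rewrite !det_mulmx mulrC mulrA -det_mulmx -map_mxM UU map_mx1 det1 mul1r //.
rewrite char_poly_trig; last exact/diag_mx_is_trig.
by apply: eq_bigr => i _; rewrite mxE eqxx mulr1n.
Qed.

(** Ties the chosen list to a diagonalization: the sorted diagonal witnesses the choice, unique
    factorization makes the chosen list a permutation of the diagonal, and [U] absorbs the
    permutation. *)
Lemma eigenvalues_spectral (R : realType) (d : nat) (X : 'M[R]_d) : X^T = X ->
  exists U : 'M[R]_d,
    [/\ U *m U^T = 1%:M, U^T *m U = 1%:M,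
        X = U^T *m diag_mx (\row_i (eigenvalues X)`_i) *m U,
        (forall i j, (i <= j < d)%N -> (eigenvalues X)`_j <= (eigenvalues X)`_i) &
        size (eigenvalues X) = d].
Proof.
move=> symX; have [V [s [VV Xeq]]] := real_spectral symX.
pose t := [tuple s 0 i | i < d].
have pt : char_poly X = \prod_(u <- t) ('X - u%:P).
  by rewrite Xeq char_poly_spectral // big_map /= big_enum.
have [so pe] : sorted >=%R (eigenvalues X) /\
    char_poly X = \prod_(u <- eigenvalues X) ('X - u%:P).
  apply: (@xgetPex _ [::] [set l : seq R | sorted >=%R l /\
                             char_poly X = \prod_(u <- l) ('X - u%:P)]).
  exists (sort >=%R t); split.
    by apply: sort_sorted => x y; rewrite orbC; exact: le_total.
  by rewrite pt; apply: perm_big; rewrite perm_sym; apply/permPl; exact: perm_sort.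
have /tuple_permP [p peq] : perm_eq (eigenvalues X) t.
  by apply: prod_XsubC_eq; rewrite -pt.
have sz : size (eigenvalues X) = d by rewrite peq size_tuple.
have nthE (i : 'I_d) : (eigenvalues X)`_i = s 0 (p i).
  by rewrite peq -tnth_nth !tnth_mktuple.
pose P : 'M[R]_d := perm_mx p.
have PP : P *m P^T = 1%:M by rewrite tr_perm_mx -perm_mxM mulgV perm_mx1.
have PP' := mulmx1C PP.
have UU : (P *m V) *m (P *m V)^T = 1%:M.
  by rewrite trmx_mul mulmxA -(mulmxA _ V) VV mulmx1.
exists (P *m V); split => //; first exact: mulmx1C.
- rewrite [LHS]Xeq trmx_mul !mulmxA; congr (_ *m _).
  rewrite -!(mulmxA V^T); congr (_ *m _).
  have -> : diag_mx (\row_i (eigenvalues X)`_i) = P *m diag_mx s *m P^T.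
    apply/matrixP => i j; rewrite /P tr_perm_mx -col_permE -row_permE !mxE nthE.
    by rewrite (inj_eq perm_inj).
  by rewrite !mulmxA PP' mul1mx -mulmxA PP' mulmx1.
- move=> i j /andP [ij jd].
  have ge_trans : transitive (>=%R : rel R) by move=> x y z /[swap]; exact: le_trans.
  apply: (sorted_leq_nth ge_trans lexx) => //; rewrite inE sz //.
  exact: leq_ltn_trans jd.
Qed.

Lemma quad_spectral (R : realType) (d : nat) (U : 'M[R]_d) (s : 'rV[R]_d) v :
  quad (U^T *m diag_mx s *m U) v = \sum_i s 0 i * (U *m v) i 0 ^+ 2.
Proof. by rewrite -[U in _ *m U]trmxK quad_conj trmxK quad_diag. Qed.

Lemma tr_spectral (R : realType) (d : nat) (U : 'M[R]_d) (s : 'rV[R]_d) :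
  U *m U^T = 1%:M -> \tr (U^T *m diag_mx s *m U) = \sum_i s 0 i.
Proof. by move=> UU; rewrite mxtrace_mulC mulmxA UU mul1mx mxtrace_diag. Qed.

Lemma psd_eigenvalue_ge0 (R : realType) (d : nat) (X : 'M[R]_d) (i : nat) :
  psd X -> 0 <= (eigenvalues X)`_i.
Proof.
move=> [symX psdX].
have [U [UU UU' Xeq _ sz]] := eigenvalues_spectral symX.
(* Past the last eigenvalue [nth] returns its default 0; otherwise the form is evaluated at an
   eigenvector. *)
have [di|id] := leqP d i; first by rewrite nth_default // sz.
have := psdX (U^T *m delta_mx (Ordinal id) 0); rewrite -/(quad X _) [in quad X _]Xeq quad_spectral.
rewrite mulmxA UU mul1mx (bigD1 (Ordinal id)) //= big1 => [|j ji].
  by rewrite addr0 !mxE !eqxx expr1n mulr1.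
by rewrite !mxE (negPf ji) expr0n mulr0.
Qed.

(* Half of the Courant-Fischer principle: the first [p.+1] eigenvectors span a
   space too large for [p] linear conditions to exclude all of it. *)
Lemma eigenvalue_witness (R : realType) (d p : nat) (X : 'M[R]_d)
    (L : 'M[R]_(p, d)) : X^T = X -> (p < d)%N ->
  exists v : 'cV[R]_d,
    [/\ v != 0, L *m v = 0 & (eigenvalues X)`_p * sqnorm v <= quad X v].
Proof.
move=> symX pd; have [U [UU UU' Xeq mono sz]] := eigenvalues_spectral symX.
(* [E] embeds p + 1 coordinates as the first ones. [N] has p rows and p + 1 columns, so its kernel
   supplies a nonzero combination of the leading eigenvectors killed by [L]. *)
pose E : 'M[R]_(d, p.+1) := \matrix_(i, j) (i == j :> nat)%:R.
pose N := L *m U^T *m E.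
have /rowV0Pn [u /sub_kermxP uN u0] : kermx N^T != 0.
  rewrite -mxrank_eq0 mxrank_ker subn_eq0 -ltnNge ltnS.
  exact: rank_leq_col.
pose w := E *m u^T.
have wE (i : 'I_p.+1) : w (widen_ord pd i) 0 = u 0 i.
  rewrite mxE (bigD1 i) //= big1 ?addr0 => [|j ji]; first by rewrite !mxE eqxx mul1r.
  by rewrite !mxE /= [_ == _ :> nat]eq_sym val_eqE (negPf ji) mul0r.
have w0 (j : 'I_d) : (p < j)%N -> w j 0 = 0.
  move=> pj; rewrite mxE big1 // => i _; rewrite !mxE gtn_eqF ?mul0r //.
  exact: leq_trans pj.
exists (U^T *m w); split.
- apply: contra_neq u0 => Uw0; have weq0 : w = 0.
    by rewrite -[w]mul1mx -UU -mulmxA Uw0 mulmx0.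
  by apply/rowP => i; rewrite -wE weq0 !mxE.
- by rewrite /w !mulmxA -/N -[_ *m _]trmxK trmx_mul trmxK uN trmx0.
- rewrite sqnorm_orth ?trmxK // [in quad X _]Xeq quad_spectral mulmxA UU mul1mx.
  rewrite sqnormE mulr_sumr; apply: ler_sum => i _; rewrite [X in _ <= X * _]mxE.
  have [ip|pi] := leqP i p; last by rewrite w0 // expr0n !mulr0.
  by rewrite ler_wpM2r ?sqr_ge0 // mono // ip.
Qed.

(** The other half of Courant-Fischer: the rows of [L] are the first [p] eigenvectors, so on its
    kernel only eigenvalues from index [p] on contribute. *)
Lemma eigenvalue_bound (R : realType) (d p : nat) (X : 'M[R]_d) :
  X^T = X -> (p < d)%N ->
  exists L : 'M[R]_(p, d), forall v : 'cV[R]_d,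
    L *m v = 0 -> quad X v <= (eigenvalues X)`_p * sqnorm v.
Proof.
move=> symX pd; have [U [UU UU' Xeq mono sz]] := eigenvalues_spectral symX.
exists (\matrix_(i, j) U (widen_ord (ltnW pd) i) j) => v Lv.
have Uv0 (i : 'I_d) : (i < p)%N -> (U *m v) i 0 = 0.
  move=> ip; have /matrixP /(_ (Ordinal ip) 0) := Lv; rewrite !mxE => {2}<-.
  apply: eq_bigr => j _; rewrite mxE; congr (U _ _ * _); exact/val_inj.
rewrite [in quad X _]Xeq quad_spectral -(sqnorm_orth v UU') sqnormE mulr_sumr.
apply: ler_sum => i _; have [ip|pi] := ltnP i p.
  by rewrite Uv0 // expr0n !mulr0.
by rewrite ler_wpM2r ?sqr_ge0 // mxE mono // pi /=.
Qed.

(** Both halves meet at a vector [v] with L C v = 0; nonnegativity of the eigenvalue of [Y] absorbs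
    the contraction. [C = 1] gives Loewner monotonicity; the general case serves conjugation by
    contractions. *)
Lemma eigenvalues_le (R : realType) (d : nat) (Y Z C : 'M[R]_d) (i : nat) :
  psd Y -> Z^T = Z -> (forall v : 'cV[R]_d, sqnorm (C *m v) <= sqnorm v) ->
  (forall v : 'cV[R]_d, quad Z v <= quad Y (C *m v)) -> (i < d)%N ->
  (eigenvalues Z)`_i <= (eigenvalues Y)`_i.
Proof.
move=> psdY symZ C1 ZY id; have [symY _] := psdY.
have [L Lb] := eigenvalue_bound symY id.
have [v [v0 Lv le1]] := eigenvalue_witness (L *m C) symZ id.
rewrite -mulmxA in Lv.
have := le_trans le1 (le_trans (ZY v) (Lb _ Lv)).
move=> /le_trans /(_ (ler_wpM2l (psd_eigenvalue_ge0 i psdY) (C1 v))).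
by rewrite ler_pM2r // sqnorm_gt0.
Qed.

(** * The trace of the shifted inverse *)

Definition inverse_trace (R : realType) (d : nat) (lambda : R) (X : 'M[R]_d) : R :=
  \tr (invmx (X + lambda%:M)).

(** Replaces the bundled element of the unit interval by a plain real [t]; minorants are tested in
    this form. *)
Lemma convex_functionP (R : realType) (d : nat) (D : set 'M[R]_d) (g : 'M[R]_d -> R) :
  convex_function D g <->
  (forall X Y t, D X -> D Y -> 0 <= t <= 1 ->
     g (t *: X + (1 - t) *: Y) <= t * g X + (1 - t) * g Y).
Proof.
split=> [cg X Y t DX DY /andP [t0 t1]|cg t X Y].
  by exact: (cg (Itv01 t0 t1) X Y (mem_set DX) (mem_set DY)).
move=> /set_mem DX /set_mem DY; apply: cg => //.
by rewrite ge0 le1.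
Qed.

Lemma quad_rank1 (R : realType) (d : nat) (a v : 'cV[R]_d) :
  quad (a *m a^T) v = (a^T *m v) 0 0 ^+ 2.
Proof.
rewrite /quad mulmxA -mulmxA [v^T *m a]mx11_scalar [a^T *m v]mx11_scalar.
rewrite -scalar_mxM !mxE eqxx mulr1n expr2; congr (_ * _).
by apply: eq_bigr => i _; rewrite !mxE mulrC.
Qed.

Lemma psdD (R : realType) (d : nat) (X Y : 'M[R]_d) : psd X -> psd Y -> psd (X + Y).
Proof.
move=> [symX pX] [symY pY]; split; first by rewrite linearD /= symX symY.
by move=> v; rewrite -/(quad _ v) quadD addr_ge0 ?pX ?pY.
Qed.

Lemma psdZ (R : realType) (d : nat) (c : R) (X : 'M[R]_d) :
  0 <= c -> psd X -> psd (c *: X).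
Proof.
move=> c0 [symX pX]; split; first by rewrite linearZ /= symX.
by move=> v; rewrite -/(quad _ v) quadZ mulr_ge0 ?pX.
Qed.

Lemma psd0 (R : realType) (d : nat) : psd (0 : 'M[R]_d).
Proof. by split=> [|v]; rewrite ?trmx0 // mulmx0 mul0mx mxE. Qed.

Lemma psd_scalar (R : realType) (d : nat) (c : R) : 0 <= c -> psd (c%:M : 'M[R]_d).
Proof.
move=> c0; split=> [|v]; first exact: tr_scalar_mx.
by rewrite -/(quad _ v) quad_scalar mulr_ge0 ?sqnorm_ge0.
Qed.

Lemma psd_rank1 (R : realType) (d : nat) (a : 'cV[R]_d) : psd (a *m a^T).
Proof.
split=> [|v]; first by rewrite trmx_mul trmxK.
by rewrite -/(quad _ v) quad_rank1 sqr_ge0.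
Qed.

Lemma psd_sum (R : realType) (d : nat) (I : finType) (P : pred I) (F : I -> 'M[R]_d) :
  (forall i, P i -> psd (F i)) -> psd (\sum_(i | P i) F i).
Proof. by move=> pF; elim/big_ind: _; [exact: psd0|exact: psdD|]. Qed.

Lemma psd_conj (R : realType) (d : nat) (X C : 'M[R]_d) :
  psd X -> psd (C *m X *m C^T).
Proof.
move=> [symX pX]; split; first by rewrite !trmx_mul trmxK symX mulmxA.
by move=> v; rewrite -/(quad _ v) quad_conj pX.
Qed.

Lemma invmx_spectral (R : realType) (d : nat) (U : 'M[R]_d) (s : 'rV[R]_d) :
  U *m U^T = 1%:M -> (forall i, s 0 i != 0) ->
  U^T *m diag_mx s *m U \in unitmx /\
  invmx (U^T *m diag_mx s *m U) = U^T *m diag_mx (\row_i (s 0 i)^-1) *m U.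
Proof.
move=> UU s0; have UU' := mulmx1C UU; set X := _ *m U; set Y := RHS.
have XY : X *m Y = 1%:M.
  rewrite /X /Y !mulmxA -[_ *m U *m U^T]mulmxA UU mulmx1.
  rewrite -[_ *m diag_mx s *m _]mulmxA mulmx_diag.
  rewrite (_ : \row_i _ = const_mx 1) ?diag_const_mx ?mulmx1 //.
  by apply/rowP => i; rewrite !mxE mulfV.
have Xu : X \in unitmx by have [] := mulmx1_unit XY.
by split=> //; rewrite -[LHS]mulmx1 -XY mulKmx.
Qed.

Lemma spectral_shift (R : realType) (d : nat) (U : 'M[R]_d) (s : 'rV[R]_d) c :
  U^T *m U = 1%:M ->
  U^T *m diag_mx s *m U + c%:M = U^T *m diag_mx (\row_i (s 0 i + c)) *m U.
Proof.
move=> UU; have -> : \row_i (s 0 i + c) = s + const_mx c.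
  by apply/rowP => i; rewrite !mxE.
rewrite linearD /= mulmxDr mulmxDl diag_const_mx mul_mx_scalar -scalemxAl UU.
by rewrite scalemx1.
Qed.

Lemma psd_shift_spectral (R : realType) (d : nat) (lambda : R) (X : 'M[R]_d) :
  0 < lambda -> psd X ->
  [/\ X + lambda%:M \in unitmx,
      exists2 U : 'M[R]_d, U^T *m U = 1%:M & invmx (X + lambda%:M) =
        U^T *m diag_mx (\row_i ((eigenvalues X)`_i + lambda)^-1) *m U &
      inverse_trace lambda X = \sum_(i < d) ((eigenvalues X)`_i + lambda)^-1].
Proof.
move=> l0 psdX; have [symX _] := psdX.
have [U [UU UU' Xeq _ _]] := eigenvalues_spectral symX.
have s0 (i : 'I_d) : (\row_i ((eigenvalues X)`_i + lambda)) 0 i != 0.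
  by rewrite mxE gt_eqF // ltr_wpDl // psd_eigenvalue_ge0.
have Xl : X + lambda%:M = U^T *m diag_mx (\row_i ((eigenvalues X)`_i + lambda)) *m U.
  rewrite [in LHS]Xeq spectral_shift //; congr (_ *m diag_mx _ *m _).
  by apply/rowP => i; rewrite !mxE.
have [Xu Xi] := invmx_spectral UU s0; rewrite -Xl in Xu Xi.
have Xi' : invmx (X + lambda%:M) =
    U^T *m diag_mx (\row_i ((eigenvalues X)`_i + lambda)^-1) *m U.
  rewrite Xi; congr (_ *m diag_mx _ *m _).
  by apply/rowP => i; rewrite !mxE.
split=> //; first by exists U.
rewrite /inverse_trace Xi' tr_spectral //.
by apply: eq_bigr => i _; rewrite mxE.
Qed.

Lemma shift_unitmx (R : realType) (d : nat) (lambda : R) (X : 'M[R]_d) :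
  0 < lambda -> psd X -> X + lambda%:M \in unitmx.
Proof. by move=> l0 /(psd_shift_spectral l0) []. Qed.

Lemma invmx_shift_sym (R : realType) (d : nat) (lambda : R) (X : 'M[R]_d) :
  psd X -> (invmx (X + lambda%:M))^T = invmx (X + lambda%:M).
Proof. by move=> [symX _]; rewrite trmx_inv linearD /= symX tr_scalar_mx. Qed.

Lemma invmx_shift_psd (R : realType) (d : nat) (lambda : R) (X : 'M[R]_d) :
  0 < lambda -> psd X -> psd (invmx (X + lambda%:M)).
Proof.
move=> l0 psdX; split=> [|v]; first exact: invmx_shift_sym.
have [_ [U _ ->] _] := psd_shift_spectral l0 psdX.
rewrite -/(quad _ v) quad_spectral sumr_ge0 // => i _; rewrite mxE.
by rewrite mulr_ge0 ?sqr_ge0 // invr_ge0 addr_ge0 ?psd_eigenvalue_ge0 // ltW.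
Qed.

(** The shifted inverse W has eigenvalues at most 1 / lambda, so W^2 <= W / lambda. *)
Lemma sqnorm_invmx_shift_le (R : realType) (d : nat) (lambda : R) (X : 'M[R]_d)
    (a : 'cV[R]_d) : 0 < lambda -> psd X ->
  sqnorm (invmx (X + lambda%:M) *m a) <= lambda^-1 * quad (invmx (X + lambda%:M)) a.
Proof.
move=> l0 psdX; have [_ [U UU ->] _] := psd_shift_spectral l0 psdX.
rewrite quad_spectral -!mulmxA sqnorm_orth ?trmxK ?(mulmx1C UU) //.
move: (U *m a) => y.
rewrite sqnormE mulr_sumr; apply: ler_sum => i _.
rewrite mul_diag_mx !mxE exprMn [leRHS]mulrA ler_wpM2r ?sqr_ge0 // expr2.
have e0 : 0 <= (eigenvalues X)`_i by exact: psd_eigenvalue_ge0.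
rewrite ler_wpM2r ?invr_ge0 ?addr_ge0 ?(ltW l0) // lef_pV2 ?posrE //; last first.
  by rewrite ltr_wpDl.
by rewrite lerDr.
Qed.

Lemma inverse_trace_ge0 (R : realType) (d : nat) (lambda : R) (X : 'M[R]_d) :
  0 < lambda -> psd X -> 0 <= inverse_trace lambda X.
Proof.
move=> l0 psdX; have [_ _ ->] := psd_shift_spectral l0 psdX.
by apply: sumr_ge0 => i _; rewrite invr_ge0 addr_ge0 ?psd_eigenvalue_ge0 // ltW.
Qed.

Lemma inverse_trace_gt0 (R : realType) (d : nat) (lambda : R) (X : 'M[R]_d) :
  (0 < d)%N -> 0 < lambda -> psd X -> 0 < inverse_trace lambda X.
Proof.
case: d X => // d X _ l0 psdX; have [_ _ ->] := psd_shift_spectral l0 psdX.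
rewrite big_ord_recl ltr_pwDl ?invr_gt0 ?ltr_wpDl ?psd_eigenvalue_ge0 //.
by apply: sumr_ge0 => i _; rewrite invr_ge0 addr_ge0 ?psd_eigenvalue_ge0 // ltW.
Qed.

Lemma inverse_trace_le (R : realType) (d : nat) (lambda : R) (X : 'M[R]_d) :
  0 < lambda -> psd X -> inverse_trace lambda X <= d%:R / lambda.
Proof.
move=> l0 psdX; have [_ _ ->] := psd_shift_spectral l0 psdX.
rewrite -[d in d%:R]card_ord mulr_natl -sumr_const; apply: ler_sum => i _.
by rewrite lef_pV2 ?posrE ?ltr_wpDl ?psd_eigenvalue_ge0 // lerDr psd_eigenvalue_ge0.
Qed.

Lemma eigenvalues_le_psdD (R : realType) (d : nat) (X F : 'M[R]_d) (i : nat) :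
  psd X -> psd F -> (i < d)%N -> (eigenvalues X)`_i <= (eigenvalues (X + F))`_i.
Proof.
move=> psdX psdF; apply: (@eigenvalues_le _ _ _ _ 1%:M).
- exact: psdD.
- by case: psdX.
- by move=> v; rewrite mul1mx.
- by move=> v; rewrite mul1mx quadD lerDl; case: psdF => _; apply.
Qed.

Lemma inverse_trace_psdD (R : realType) (d : nat) (lambda : R) (X F : 'M[R]_d) :
  0 < lambda -> psd X -> psd F ->
  inverse_trace lambda (X + F) <= inverse_trace lambda X.
Proof.
move=> l0 psdX psdF; have [_ _ ->] := psd_shift_spectral l0 psdX.
have [_ _ ->] := psd_shift_spectral l0 (psdD psdX psdF).
apply: ler_sum => i _.
rewrite lef_pV2 ?posrE ?ltr_wpDl ?psd_eigenvalue_ge0 //; last exact: psdD.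
by rewrite lerD2r eigenvalues_le_psdD.
Qed.

Lemma trace_conj_ge0 (R : realType) (d : nat) (X B : 'M[R]_d) :
  psd X -> 0 <= \tr (B^T *m X *m B).
Proof.
move=> [_ pX]; apply: sumr_ge0 => j _.
have := pX (col j B); rewrite !colE trmx_mul -/(quad _ _).
rewrite trmx_delta -!mulmxA -rowE !mulmxA -colE !mxE.
by congr (0 <= _).
Qed.

(* Equality holds at [N = (X + lambda)^-1], so [inverse_trace] is a supremum of
   affine functions, hence convex. *)
Lemma inverse_trace_tangent (R : realType) (d : nat) (lambda : R) (X N : 'M[R]_d) :
  0 < lambda -> psd X -> N^T = N ->
  2 * \tr N - \tr (N *m (X + lambda%:M) *m N) <= inverse_trace lambda X.
Proof.
move=> l0 psdX symN; have Xu := shift_unitmx l0 psdX.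
rewrite /inverse_trace; set M := X + _ in Xu *; set W := invmx M.
have symW : W^T = W by exact: invmx_shift_sym.
have psdM : psd M by apply: psdD psdX (psd_scalar _ (ltW l0)).
(* Completing the square: the trace of (W - N) M (W - N) is tr W - 2 tr N + tr (N M N). *)
have := trace_conj_ge0 (W - N) psdM.
have -> : (W - N)^T = W - N by rewrite linearB /= symW symN.
rewrite mulmxBl mulVmx // mulmxBr !mulmxBl !mul1mx mulmxK //.
rewrite !linearB /=; lra.
Qed.

(** * Gamma and its convex envelope *)

Lemma trace_eigenvalues (R : realType) (d : nat) (X : 'M[R]_d) :
  X^T = X -> \tr X = \sum_(i < d) (eigenvalues X)`_i.
Proof.
move=> symX; have [U [UU _ Xeq _ _]] := eigenvalues_spectral symX.
rewrite [in LHS]Xeq tr_spectral //; by apply: eq_bigr => i _; rewrite mxE.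
Qed.

Lemma inv_shift_lipschitz (R : realFieldType) (lambda y z : R) :
  0 < lambda -> 0 <= z <= y ->
  (z + lambda)^-1 <= (y + lambda)^-1 + (y - z) / lambda ^+ 2.
Proof.
move=> l0 /andP [z0 zy].
have zl : 0 < z + lambda by rewrite ltr_wpDl.
have yl : 0 < y + lambda by rewrite ltr_wpDl // (le_trans z0).
rewrite -lerBlDl; have -> : (z + lambda)^-1 - (y + lambda)^-1 =
    (y - z) / ((z + lambda) * (y + lambda)) by field; rewrite !gt_eqF.
rewrite ler_wpM2l ?subr_ge0 // lef_pV2 ?posrE ?mulr_gt0 ?exprn_gt0 //.
by rewrite expr2 ler_pM ?lerDr ?(ltW l0) // (le_trans z0).
Qed.

Lemma Gamma_ge0 (R : realType) (d m : nat) (lambda : R) (X : 'M[R]_d) :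
  0 < lambda -> psd X -> 0 <= Gamma m lambda X.
Proof.
move=> l0 psdX; apply: sumr_ge0 => i _.
by rewrite invr_ge0 addr_ge0 ?psd_eigenvalue_ge0 // ltW.
Qed.

Lemma inverse_trace_Gamma (R : realType) (d m : nat) (lambda : R) (X : 'M[R]_d) :
  (m <= d)%N -> 0 < lambda -> psd X -> inverse_trace lambda X =
  Gamma m lambda X + \sum_(m <= i < d) ((eigenvalues X)`_i + lambda)^-1.
Proof.
move=> md l0 psdX; have [_ _ ->] := psd_shift_spectral l0 psdX.
rewrite /Gamma -!(big_mkord xpredT (fun i => ((eigenvalues X)`_i + lambda)^-1)).
by rewrite (big_cat_nat (leq0n m) md).
Qed.

(** Each of the d - m discarded eigenvalues contributes at most 1 / lambda. *)
Lemma inverse_trace_le_Gamma (R : realType) (d m : nat) (lambda : R) (X : 'M[R]_d) :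
  (m <= d)%N -> 0 < lambda -> psd X ->
  inverse_trace lambda X <= Gamma m lambda X + (d%:R - m%:R) / lambda.
Proof.
move=> md l0 psdX; rewrite (inverse_trace_Gamma md l0 psdX) lerD2l.
rewrite -natrB // mulr_natl -sumr_const_nat; apply: ler_sum => i _.
by rewrite lef_pV2 ?posrE ?ltr_wpDl ?psd_eigenvalue_ge0 // lerDr psd_eigenvalue_ge0.
Qed.

Lemma inverse_trace_low_rank (R : realType) (d m : nat) (lambda : R) (X : 'M[R]_d) :
  (m <= d)%N -> 0 < lambda -> psd X ->
  (forall i, (m <= i < d)%N -> (eigenvalues X)`_i = 0) ->
  inverse_trace lambda X = Gamma m lambda X + (d%:R - m%:R) / lambda.
Proof.
move=> md l0 psdX X0; rewrite (inverse_trace_Gamma md l0 psdX); congr (_ + _).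
rewrite -natrB // mulr_natl -sumr_const_nat; apply: eq_big_nat => i id.
by rewrite X0 // add0r.
Qed.

Lemma Gamma_psdD (R : realType) (d m : nat) (lambda : R) (X F : 'M[R]_d) :
  (m <= d)%N -> 0 < lambda -> psd X -> psd F ->
  Gamma m lambda (X + F) <= Gamma m lambda X.
Proof.
move=> md l0 psdX psdF; have psdXF := psdD psdX psdF.
apply: ler_sum => i _.
rewrite lef_pV2 ?posrE ?ltr_wpDl ?psd_eigenvalue_ge0 //.
by rewrite lerD2r eigenvalues_le_psdD // (leq_trans _ md).
Qed.

(** Every eigenvalue decreases, at a Lipschitz cost of 1 / lambda^2. The first m gaps are bounded by
    all d gaps, so that the error is a trace, linear in [Y], and can be subtracted from a convex
    minorant. *)
Lemma Gamma_contraction (R : realType) (d m : nat) (lambda : R) (Y C : 'M[R]_d) :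
  (m <= d)%N -> 0 < lambda -> psd Y ->
  (forall v : 'cV[R]_d, sqnorm (C^T *m v) <= sqnorm v) ->
  Gamma m lambda (C *m Y *m C^T) <=
  Gamma m lambda Y + (\tr Y - \tr (C *m Y *m C^T)) / lambda ^+ 2.
Proof.
move=> md l0 psdY C1; have psdZ' := psd_conj C psdY.
have [symY _] := psdY; have [symZ _] := psdZ'.
have le_eig (i : 'I_d) : (eigenvalues (C *m Y *m C^T))`_i <= (eigenvalues Y)`_i.
  by apply: (eigenvalues_le psdY symZ C1) => // v; rewrite quad_conj.
rewrite !trace_eigenvalues // -sumrB.
have : Gamma m lambda (C *m Y *m C^T) <= Gamma m lambda Y +
    \sum_(i < m) ((eigenvalues Y)`_i - (eigenvalues (C *m Y *m C^T))`_i) / lambda ^+ 2.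
  rewrite -big_split; apply: ler_sum => i _ /=.
  apply: inv_shift_lipschitz => //; rewrite psd_eigenvalue_ge0 //=.
  exact: (le_eig (widen_ord md i)).
move=> /le_trans; apply; rewrite lerD2l -mulr_suml ler_wpM2r ?invr_ge0 ?exprn_ge0 ?(ltW l0) //.
rewrite -(big_mkord xpredT (fun i => (eigenvalues Y)`_i - (eigenvalues (C *m Y *m C^T))`_i)).
rewrite -(big_mkord xpredT (fun i => (eigenvalues Y)`_i - (eigenvalues (C *m Y *m C^T))`_i)).
rewrite [leRHS](big_cat_nat (leq0n m) md) //= lerDl big_nat sumr_ge0 // => i /andP [_ id].
by rewrite subr_ge0 (le_eig (Ordinal id)).
Qed.

(** Termwise 1 / t >= 2 u - u^2 t, the tangent of the inverse at t = 1 / u; the sum of the first m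
    eigenvalues is then bounded by the trace. *)
Lemma Gamma_tangent (R : realType) (d m : nat) (lambda u : R) (X : 'M[R]_d) :
  (m <= d)%N -> 0 < lambda -> psd X ->
  m%:R * (2 * u - u ^+ 2 * lambda) - u ^+ 2 * \tr X <= Gamma m lambda X.
Proof.
move=> md l0 psdX; rewrite trace_eigenvalues; last by case: psdX.
apply: (@le_trans _ _ (\sum_(i < m) (2 * u - u ^+ 2 * ((eigenvalues X)`_i + lambda)))).
  rewrite (eq_bigr (fun i : 'I_m => (2 * u - u ^+ 2 * lambda) - u ^+ 2 * (eigenvalues X)`_i));
    last by move=> i _; ring.
  rewrite sumrB sumr_const card_ord mulr_natl lerD2l lerN2 -mulr_sumr.
  rewrite ler_wpM2l ?sqr_ge0 //.
  rewrite -!(big_mkord xpredT (fun i => (eigenvalues X)`_i)).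
  rewrite [leRHS](big_cat_nat (leq0n m) md) //= lerDl sumr_ge0 // => i _.
  exact: psd_eigenvalue_ge0.
apply: ler_sum => i _; set t := _ + lambda.
have t0 : 0 < t by rewrite ltr_wpDl ?psd_eigenvalue_ge0.
rewrite -subr_ge0; have -> : t^-1 - (2 * u - u ^+ 2 * t) = t * (t^-1 - u) ^+ 2.
  by field; rewrite gt_eqF.
by rewrite mulr_ge0 ?sqr_ge0 ?ltW.
Qed.

Section ConvGamma.
Variables (R : realType) (d m : nat) (lambda : R).
Hypotheses (md : (m <= d)%N) (lambda_gt0 : 0 < lambda).
Implicit Types (X Y F : 'M[R]_d) (g : 'M[R]_d -> R).

Let minorant g :=
  (forall X Y t, psd X -> psd Y -> 0 <= t <= 1 ->
     g (t *: X + (1 - t) *: Y) <= t * g X + (1 - t) * g Y) /\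
  forall Y, psd Y -> g Y <= Gamma m lambda Y.

Lemma conv_Gamma_minorant g X :
  psd X -> minorant g -> g X <= conv_Gamma m lambda X.
Proof.
move=> psdX [cg leg]; apply: ub_le_sup.
  by exists (Gamma m lambda X) => _ [h [_ leh] <-]; exact: leh.
by exists g => //; split=> //; apply/convex_functionP.
Qed.

Lemma conv_Gamma_le X c : psd X ->
  (forall g, minorant g -> g X <= c) -> conv_Gamma m lambda X <= c.
Proof.
move=> psdX gc; apply: ge_sup.
  (* The zero minorant makes the set under the supremum nonempty. *)
  exists 0, (fun=> 0) => //; split; last by move=> Y psdY; exact: Gamma_ge0.
  by apply/convex_functionP => *; rewrite !mulr0 addr0.
move=> _ [g [cg leg] <-]; apply: gc; split=> //.
by move/convex_functionP: cg.
Qed.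

Lemma conv_Gamma_ge0 X : psd X -> 0 <= conv_Gamma m lambda X.
Proof.
move=> psdX; apply: (@conv_Gamma_minorant (fun=> 0)) => //; split.
  by move=> *; rewrite !mulr0 addr0.
by move=> Y psdY; exact: Gamma_ge0.
Qed.

Lemma conv_Gamma_le_Gamma X : psd X -> conv_Gamma m lambda X <= Gamma m lambda X.
Proof. by move=> psdX; apply: conv_Gamma_le => // g [_]; apply. Qed.

Lemma conv_Gamma_tangent X u : psd X ->
  m%:R * (2 * u - u ^+ 2 * lambda) - u ^+ 2 * \tr X <= conv_Gamma m lambda X.
Proof.
move=> psdX; apply: (@conv_Gamma_minorant
  (fun Y => m%:R * (2 * u - u ^+ 2 * lambda) - u ^+ 2 * \tr Y)) => //; split.
  by move=> Y Z t _ _ _; rewrite mxtraceD !mxtraceZ; lra.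
by move=> Y psdY; exact: Gamma_tangent.
Qed.

Lemma inverse_trace_le_conv_Gamma X : psd X ->
  inverse_trace lambda X <= conv_Gamma m lambda X + (d%:R - m%:R) / lambda.
Proof.
move=> psdX; rewrite -lerBlDr; apply: (@conv_Gamma_minorant
  (fun Y => inverse_trace lambda Y - (d%:R - m%:R) / lambda)) => //; split; last first.
  by move=> Y psdY; rewrite lerBlDr inverse_trace_le_Gamma.
move=> Y Z t psdY psdZ' /andP [t0 t1]; set V := _ + (1 - t) *: Z.
have psdV : psd V by apply: psdD; apply: psdZ => //; rewrite subr_ge0.
(* Both tangent inequalities are taken at the inverse belonging to the mixture [V], where the
   tangent is exact. *)
set N := invmx (V + lambda%:M).
have symN : N^T = N by exact: invmx_shift_sym.
have tY := inverse_trace_tangent lambda_gt0 psdY symN.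
have tZ := inverse_trace_tangent lambda_gt0 psdZ' symN.
have -> : inverse_trace lambda V = 2 * \tr N - \tr (N *m (V + lambda%:M) *m N).
  rewrite /N mulVmx ?mul1mx ?shift_unitmx // -/N /inverse_trace -/N; ring.
have -> : V + lambda%:M = t *: (Y + lambda%:M) + (1 - t) *: (Z + lambda%:M).
  rewrite !scalerDr addrACA -scalerDl /V; congr (_ + _).
  by rewrite addrC subrK scale1r.
rewrite mulmxDr mulmxDl -!scalemxAr -!scalemxAl mxtraceD !mxtraceZ.
have := lerD (ler_wpM2l t0 tY) (ler_wpM2l (_ : 0 <= 1 - t) tZ).
rewrite subr_ge0 => /(_ t1); lra.
Qed.

(** Translating a convex minorant by [F] gives another one, because [Gamma] is antitone. *)
Lemma conv_Gamma_psdD X F : psd X -> psd F ->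
  conv_Gamma m lambda (X + F) <= conv_Gamma m lambda X.
Proof.
move=> psdX psdF; apply: conv_Gamma_le; first exact: psdD.
move=> g [cg leg]; apply: (@conv_Gamma_minorant (fun Y => g (Y + F))) => //; split.
  move=> Y Z t psdY psdZ' t01.
  have -> : t *: Y + (1 - t) *: Z + F = t *: (Y + F) + (1 - t) *: (Z + F).
    rewrite !scalerDr addrACA -scalerDl; congr (_ + _).
    by rewrite addrC subrK scale1r.
  by apply: cg => //; exact: psdD.
move=> Y psdY; apply: le_trans (Gamma_psdD md lambda_gt0 psdY psdF).
by apply: leg; exact: psdD.
Qed.

(* With [C] diagonal in an eigenbasis of [X] and [C (X + delta) C^T = X], a
   convex minorant [g] yields the convex minorant
   [Y |-> g (C Y C^T) - (tr Y - tr (C Y C^T)) / lambda ^ 2]. *)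
Lemma conv_Gamma_scalar X delta : psd X -> 0 < delta ->
  conv_Gamma m lambda X <=
  conv_Gamma m lambda (X + delta%:M) + d%:R * delta / lambda ^+ 2.
Proof.
move=> psdX delta0; apply: conv_Gamma_le => // g [cg leg].
have [symX _] := psdX; have [U [UU UU' Xeq _ _]] := eigenvalues_spectral symX.
pose e (i : nat) := (eigenvalues X)`_i.
have e0 i : 0 <= e i by exact: psd_eigenvalue_ge0.
have ed i : 0 < e i + delta by rewrite ltr_wpDl.
(* Conjugation multiplies the i-th eigenvalue by the square of this entry, sending e_i + delta to
   e_i; entries are at most 1, so [C] is a contraction. *)
pose c := \row_(i < d) Num.sqrt (e i / (e i + delta)).
pose C := U^T *m diag_mx c *m U.
have symC : C^T = C by rewrite /C !trmx_mul trmxK tr_diag_mx mulmxA.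
have CX : C *m (X + delta%:M) *m C^T = X.
  rewrite symC [in LHS]Xeq spectral_shift // /C.
  rewrite !mulmxA -[_ *m U *m U^T]mulmxA UU mulmx1 -[_ *m U *m U^T]mulmxA UU mulmx1.
  rewrite -[U^T *m _ *m _]mulmxA mulmx_diag -[U^T *m _ *m _]mulmxA mulmx_diag.
  rewrite [RHS]Xeq; congr (_ *m diag_mx _ *m _); apply/rowP => i; rewrite !mxE.
  rewrite mulrAC -expr2 sqr_sqrtr ?divr_ge0 ?(ltW (ed i)) // -/(e i).
  by rewrite divfK ?gt_eqF.
have C1 (v : 'cV[R]_d) : sqnorm (C^T *m v) <= sqnorm v.
  rewrite symC -!mulmxA sqnorm_orth ?trmxK // -[leRHS](sqnorm_orth v UU').
  move: (U *m v) => w; rewrite !sqnormE; apply: ler_sum => i _.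
  rewrite mul_diag_mx !mxE exprMn sqr_sqrtr ?divr_ge0 ?(ltW (ed i)) //.
  by rewrite ler_piMl ?sqr_ge0 // ler_pdivrMr // mul1r lerDl ltW.
pose h Y := g (C *m Y *m C^T) - (\tr Y - \tr (C *m Y *m C^T)) / lambda ^+ 2.
have psdXd : psd (X + delta%:M) by apply: psdD psdX (psd_scalar _ (ltW delta0)).
have : h (X + delta%:M) <= conv_Gamma m lambda (X + delta%:M).
  apply: conv_Gamma_minorant => //; split=> [Y Z t psdY psdZ' t01|Y psdY]; last first.
    rewrite /h lerBlDr; apply: le_trans (Gamma_contraction md lambda_gt0 psdY C1).
    by apply: leg; exact: psd_conj.
  rewrite /h mulmxDr mulmxDl -!scalemxAr -!scalemxAl.
  have := cg _ _ t (psd_conj C psdY) (psd_conj C psdZ') t01.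
  rewrite !mxtraceD !mxtraceZ; lra.
rewrite /h CX mxtraceD mxtrace_scalar -[delta *+ d]mulr_natl addrAC subrr add0r.
by rewrite lerBlDr.
Qed.

End ConvGamma.

(** * Averages of determinants over rank-one updates *)

Lemma deriv_prod (R : comNzRingType) (I : eqType) (r : seq I) (F : I -> {poly R}) :
  uniq r -> (\prod_(i <- r) F i)^`() =
  \sum_(i <- r) (F i)^`() * \prod_(j <- r | j != i) F j.
Proof.
elim: r => [|x r IHr] /=; first by rewrite !big_nil derivC.
move=> /andP [xr ur]; rewrite !big_cons derivM IHr // eqxx /=.
congr (_ * _ + _).
  by rewrite [RHS]big_seq_cond [LHS]big_seq; apply: eq_bigl => i;
    case: (boolP (i \in r)) => //= ir; symmetry; apply: contraNneq xr => <-.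
rewrite mulr_sumr !big_seq; apply: eq_bigr => i ir.
rewrite big_cons ifT; first by rewrite mulrCA.
by apply: contraNneq xr => ->.
Qed.

(** Jacobi's formula: the Leibniz expansion is differentiated one row at a time, and each resulting
    determinant is expanded along that row. *)
Lemma deriv_det (R : comNzRingType) (n : nat) (N : 'M[{poly R}]_n) :
  (\det N)^`() = \tr (\adj N *m map_mx (@deriv R) N).
Proof.
pose M i := \matrix_(j, l) if j == i then (N j l)^`() else N j l.
transitivity (\sum_i \det (M i)).
  rewrite /determinant linear_sum /= exchange_big /=; apply: eq_bigr => s _.
  rewrite -signr_odd mulr_sign (fun_if (@deriv R)) derivN deriv_prod ?index_enum_uniq //.
  rewrite -mulr_sign -mulr_sumr; congr (_ * _); apply: eq_bigr => i _.
  rewrite [RHS](bigD1 i) //= mxE eqxx; congr (_ * _).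
  by apply: eq_bigr => j ji; rewrite mxE (negPf ji).
rewrite mxtrace_mulC; apply: eq_bigr => i _.
rewrite (expand_det_row _ i) mxE; apply: eq_bigr => j _; rewrite !mxE eqxx.
congr (_ * _); rewrite /cofactor; congr (_ * \det _).
by apply/matrixP => k l; rewrite !mxE eq_sym (negPf (neq_lift _ _)).
Qed.

(** The bordered determinant [Z] is computed twice, by eliminating [u] and by multiplying with a
    matrix built from the adjugate. Cancelling det M replaces inversion, so polynomial entries are
    allowed. *)
Lemma det_rank1_update (R : idomainType) (n : nat) (M : 'M[R]_n) (u : 'cV[R]_n)
    (v : 'rV[R]_n) : \det M != 0 ->
  \det (M + u *m v) = \det M + (v *m \adj M *m u) 0 0.
Proof.
move=> M0; pose Z := block_mx (1%:M : 'M[R]_1) (- v) u M.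
have ZE : \det Z = \det (M + u *m v).
  pose L := block_mx (1%:M : 'M[R]_1) 0 (- u) (1%:M : 'M[R]_n).
  have <- : \det (L *m Z) = \det Z.
    by rewrite det_mulmx det_lblock !det1 !mul1r.
  rewrite mulmx_block !mul1mx !mul0mx !addr0 mulmx1 mulNmx mulmxN opprK.
  by rewrite addNr det_ublock det1 mul1r addrC.
pose T := block_mx ((\det M)%:M : 'M[R]_1) 0 (- (\adj M *m u)) (1%:M : 'M[R]_n).
have : \det (Z *m T) = \det Z * \det M.
  by rewrite det_mulmx det_lblock det1 mulr1 det_scalar1.
rewrite mulmx_block !mulmx0 !mulmx1 !add0r !mul1mx.
rewrite !mulmxN (mulmxA M) mul_mx_adj mul_mx_scalar mul_scalar_mx subrr.
rewrite det_ublock mulNmx opprK => /(mulIf M0); rewrite ZE => <-.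
by rewrite det_mx11 mxE mulmxA [X in X + _]mxE eqxx mulr1n.
Qed.

Section RankOneSampling.
Variables (R : idomainType) (n d : nat) (a : 'I_n -> 'cV[R]_d) (x : 'I_n -> R).

Definition weighted_gram : 'M[R]_d := \sum_i x i *: (a i *m (a i)^T).

(* The sum, over all [p]-tuples [g] of indices, of [x^g] times the value of [F] at
   [M + sum_l a_(g l) a_(g l)^T]. *)
Fixpoint rank1_average (V : lmodType R) (p : nat) (F : 'M[R]_d -> V) (M : 'M[R]_d) : V :=
  if p is p'.+1 then
    \sum_i x i *: rank1_average p' F (M + a i *m (a i)^T)
  else F M.

Definition shifted_det (M : 'M[R]_d) : {poly R} :=
  \det ('X%:M + map_mx polyC M).

(** This is det (X I + M + Y A): the outer indeterminate is Y, and X lives in the coefficients. *)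
Definition pencil_det (A M : 'M[R]_d) : {poly {poly R}} :=
  \det (map_mx polyC ('X%:M + map_mx polyC M)
        + 'X *: map_mx (polyC \o polyC) A).

Lemma shifted_det_char_poly (M : 'M[R]_d) : shifted_det M = char_poly (- M).
Proof. by rewrite /shifted_det /char_poly /char_poly_mx map_mxN opprK. Qed.

Lemma coef0_pencil_det A M : (pencil_det A M)`_0 = shifted_det M.
Proof.
rewrite -horner_coef0 /pencil_det -[LHS]/(horner_eval 0 _) -det_map_mx.
congr (\det _); apply/matrixP => i j.
by rewrite !mxE /= /horner_eval hornerD hornerM hornerX mul0r addr0 hornerC.
Qed.

(** At Y = 0 the pencil is monic in X. This licenses [det_rank1_update]. *)
Lemma pencil_det_neq0 A M : pencil_det A M != 0.
Proof.
apply/eqP => h0; have := coef0_pencil_det A M; rewrite h0 coef0 => /esym/eqP.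
by rewrite shifted_det_char_poly (negPf (monic_neq0 (char_poly_monic _))).
Qed.

(** Each rank-one update adds tr (adj N b_i b_i^T); weighted by x the matrices b_i b_i^T add up to
    dN/dY, and Jacobi's formula identifies the total with the Y-derivative. *)
Lemma pencil_det_average (M : 'M[R]_d) :
  \sum_i (x i)%:P%:P * pencil_det weighted_gram (M + a i *m (a i)^T) =
  (\sum_i x i)%:P%:P * pencil_det weighted_gram M + (pencil_det weighted_gram M)^`().
Proof.
pose N : 'M[{poly {poly R}}]_d := map_mx polyC ('X%:M + map_mx polyC M)
  + 'X *: map_mx (polyC \o polyC) weighted_gram.
have -> : pencil_det weighted_gram M = \det N by [].
set P := \det N.
pose b i := map_mx (polyC \o polyC) (a i).
have step i : pencil_det weighted_gram (M + a i *m (a i)^T) =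
    P + \tr (\adj N *m (b i *m (b i)^T)).
  transitivity (\det (N + b i *m (b i)^T)).
    rewrite /pencil_det; congr (\det _).
    rewrite /N addrAC; congr (_ + _).
    rewrite /b map_trmx -map_mxM !map_mxD addrA; congr (_ + _).
    by rewrite -map_mx_comp.
  rewrite det_rank1_update ?pencil_det_neq0 //; congr (_ + _).
  by rewrite mulmxA mxtrace_mulC mulmxA trace_mx11.
rewrite (eq_bigr (fun i => (x i)%:P%:P * P + (x i)%:P%:P * \tr (\adj N *m (b i *m (b i)^T))));
  last by move=> i _; rewrite step mulrDr.
rewrite big_split /= -mulr_suml; congr (_ + _); first by rewrite !rmorph_sum.
rewrite /P deriv_det.
have -> : map_mx deriv N = \sum_i (x i)%:P%:P *: (b i *m (b i)^T).
  rewrite /N /weighted_gram; apply/matrixP => k l.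
  rewrite !mxE derivD derivC add0r derivM derivX mul1r derivC mulr0 addr0 /=.
  rewrite !summxE !rmorph_sum; apply: eq_bigr => i _.
  rewrite !mxE !rmorphM /=; congr (_ * _); rewrite !rmorph_sum.
  by apply: eq_bigr => j _; rewrite !mxE !rmorphM.
rewrite mulmx_sumr linear_sum; apply: eq_bigr => i _.
by rewrite -scalemxAr linearZ.
Qed.

Lemma coef_pencil_det_average (M : 'M[R]_d) (r : nat) :
  \sum_i x i *: (pencil_det weighted_gram (M + a i *m (a i)^T))`_r =
  (\sum_i x i) *: (pencil_det weighted_gram M)`_r +
  (pencil_det weighted_gram M)`_r.+1 *+ r.+1.
Proof.
have := congr1 (fun p : {poly {poly R}} => p`_r) (pencil_det_average M).
rewrite coefD coef_sum coefCM coef_deriv mul_polyC => <-.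
by apply: eq_bigr => i _; rewrite coefCM mul_polyC.
Qed.

(** Iterating [pencil_det_average] applies (w + d/dY)^p, with w the sum of the weights, read at Y =
    0: the binomial theorem gives the factors, and the r-th derivative at 0 is r! times a
    coefficient. The induction step is Pascal's rule. *)
Lemma rank1_average_shifted_det (p : nat) (M : 'M[R]_d) :
  rank1_average p shifted_det M =
  \sum_(r < p.+1) (('C(p, r) * r`!)%:R * (\sum_i x i) ^+ (p - r)) *:
     (pencil_det weighted_gram M)`_r.
Proof.
set w := \sum_i x i; elim: p M => [|p IHp] M.
  by rewrite big_ord1 /= mulr1 scale1r coef0_pencil_det.
rewrite /=; under eq_bigr do rewrite IHp scaler_sumr.
rewrite exchange_big /=.
pose c q r := ('C(q, r) * r`!)%:R * w ^+ (q - r) : R.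
pose h r := (pencil_det weighted_gram M)`_r.
transitivity (\sum_(r < p.+1) (c p r *: (w *: h r) + c p r *: (h r.+1 *+ r.+1))).
  apply: eq_bigr => r _; rewrite -scalerDr -/w -coef_pencil_det_average scaler_sumr.
  by apply: eq_bigr => i _; rewrite !scalerA mulrC.
rewrite big_split /= [RHS]big_ord_recl /=.
have -> : \sum_(r < p.+1) c p r *: (w *: h r) =
    (c p.+1 0%N) *: h 0%N + \sum_(r < p.+1) (('C(p, r.+1) * (r.+1)`!)%:R * w ^+ (p - r)) *: h r.+1.
  rewrite big_ord_recl big_ord_recr /= bin_small // mul0n mul0r scale0r addr0.
  rewrite scalerA /c !bin0 !subn0 -mulrA -exprSr; congr (_ + _).
  apply: eq_bigr => r _; rewrite scalerA /c -mulrA -exprSr; congr ((_ * _ ^+ _) *: _).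
  by rewrite /bump /= add1n subnSK.
rewrite -addrA; congr (_ + _); rewrite -big_split; apply: eq_bigr => r _ /=.
rewrite -scalerMnr -scaler_nat scalerA -scalerDl; congr (_ *: _).
rewrite /bump /= add1n subSS binS mulnDl natrD mulrDl; congr (_ + _).
by rewrite /c factS !natrM; ring.
Qed.
End RankOneSampling.

(** The product of the X + e Y is homogeneous, so its Y^r coefficient is the r-th elementary
    symmetric function times X^j. *)
Lemma coef_homogenized (R : comNzRingType) (s : seq R) (r j : nat) :
  (r + j)%N = size s ->
  (\prod_(e <- s) ('X%:P + e%:P%:P * 'X : {poly {poly R}}))`_r =
  (\prod_(e <- s) ('X + e%:P))`_j *: 'X^j.
Proof.
pose q s := \prod_(e <- s) ('X + e%:P) : {poly R}.
pose Q s := \prod_(e <- s) ('X%:P + e%:P%:P * 'X) : {poly {poly R}}.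
rewrite -/(q s) -/(Q s).
have qS e t i : (q (e :: t))`_i = (if i == 0%N then 0 else (q t)`_i.-1) + e * (q t)`_i.
  by rewrite /q big_cons mulrDl coefD coefXM coefCM.
have QS e t i : (Q (e :: t))`_i =
    'X * (Q t)`_i + (if i == 0%N then 0 else e%:P * (Q t)`_i.-1).
  by rewrite /Q big_cons mulrDl coefD coefCM -mulrA coefCM coefXM; case: eqP; rewrite ?mulr0.
have q0 t i : (size t < i)%N -> (q t)`_i = 0.
  elim: t i => [|e t IHt] [|i] //= ti; first by rewrite /q big_nil coef1.
  by rewrite qS /= !IHt ?mulr0 ?addr0 // ltnW.
have Q0 t i : (size t < i)%N -> (Q t)`_i = 0.
  elim: t i => [|e t IHt] [|i] //= ti; first by rewrite /Q big_nil coef1.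
  by rewrite QS /= !IHt ?mulr0 ?addr0 // ltnW.
elim: s r j => [|e s IHs] r j /=.
  by case: r j => [|r] [|j] //; rewrite /q /Q !big_nil !coef1 eqxx scale1r expr0.
rewrite qS QS; case: r => [|r] rj /=.
  move: rj; rewrite add0n => ->; rewrite /= (IHs _ (size s)) // [(q s)`_(size s).+1]q0 //.
  by rewrite mulr0 !addr0 exprS -scalerAr.
have {}rj : (r + j)%N = size s by case: rj.
rewrite (IHs _ _ rj) mul_polyC scalerA scalerDl; congr (_ + _).
case: j rj => [|j] rj /=; first by rewrite Q0 -?rj ?addn0 // mulr0 scale0r.
by rewrite (IHs _ j) ?exprS -?scalerAr // addSnnS.
Qed.

(** The weights x^g are nonnegative, so the average stays in any convex cone containing [F] at every
    Gram sum. Tuples appear as lists of size [p], repetitions included. *)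
Lemma rank1_average_cone (R : realType) (n d p : nat) (a : 'I_n -> 'cV[R]_d)
    (x : 'I_n -> R) (V : lmodType R) (F : 'M[R]_d -> V) (C : V -> Prop) (M : 'M[R]_d) :
  C 0 -> (forall u v, C u -> C v -> C (u + v)) ->
  (forall c u, 0 <= c -> C u -> C (c *: u)) -> (forall i, 0 <= x i) ->
  (forall s : seq 'I_n, size s = p -> C (F (M + \sum_(i <- s) a i *m (a i)^T))) ->
  C (rank1_average a x p F M).
Proof.
move=> C0 CD CZ x0; elim: p M => [|p IHp] M CF /=.
  by have := CF [::] erefl; rewrite big_nil addr0.
elim/big_ind: _ => // i _; apply: CZ => //; apply: IHp => s sp.
by have := CF (i :: s); rewrite /= sp big_cons addrA; apply.
Qed.

(** The ring is general because this is applied over [{poly R}] and over [{poly {poly R}}]. *)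
Lemma det_shifted_conj_diag (T : comNzRingType) (d : nat) (V : 'M[T]_d)
    (s : 'rV[T]_d) (c t : T) : V^T *m V = 1%:M ->
  \det (c%:M + t *: (V^T *m diag_mx s *m V)) = \prod_i (c + t * s 0 i).
Proof.
move=> VV; have -> : c%:M + t *: (V^T *m diag_mx s *m V) =
    V^T *m (c%:M + t *: diag_mx s) *m V.
  rewrite mulmxDr mulmxDl -scalemxAr -scalemxAl mul_mx_scalar -scalemxAl VV.
  by rewrite scalemx1.
rewrite !det_mulmx mulrAC -det_mulmx VV det1 mul1r.
have -> : c%:M + t *: diag_mx s = diag_mx (\row_i (c + t * s 0 i)).
  by apply/matrixP => i j; rewrite !mxE; case: eqP => _; rewrite ?mulr1n // !mulr0n mulr0 addr0.
by rewrite det_diag; apply: eq_bigr => i _; rewrite mxE.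
Qed.

Section SampledCoefficients.
Variables (R : realType) (n d : nat) (a : 'I_n -> 'cV[R]_d) (x : 'I_n -> R).

Lemma shifted_det_eigenvalues (M : 'M[R]_d) : M^T = M ->
  shifted_det M = \prod_(e <- eigenvalues M) ('X + e%:P).
Proof.
move=> symM; have [U [UU UU' Meq _ sz]] := eigenvalues_spectral symM.
rewrite /shifted_det [in LHS]Meq !map_mxM -map_trmx map_diag_mx -[X in _ + X]scale1r.
rewrite det_shifted_conj_diag; last by rewrite map_trmx -map_mxM UU' map_mx1.
rewrite (big_nth 0) sz big_mkord; apply: eq_bigr => i _.
by rewrite !mxE mul1r.
Qed.

Lemma pencil_det_eigenvalues (M : 'M[R]_d) : M^T = M ->
  pencil_det M 0 = \prod_(e <- eigenvalues M) ('X%:P + e%:P%:P * 'X).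
Proof.
move=> symM; have [U [UU UU' Meq _ sz]] := eigenvalues_spectral symM.
rewrite /pencil_det map_mx0 addr0 map_scalar_mx [in LHS]Meq !map_mxM -map_trmx map_diag_mx.
rewrite det_shifted_conj_diag; last by rewrite map_trmx -map_mxM UU' map_mx1.
rewrite (big_nth 0) sz big_mkord; apply: eq_bigr => i _.
by rewrite !mxE mulrC.
Qed.

Lemma weighted_gram_sym : (weighted_gram a x)^T = weighted_gram a x.
Proof.
rewrite /weighted_gram linear_sum; apply: eq_bigr => i _.
by rewrite linearZ /= trmx_mul trmxK.
Qed.

(** At M = 0 the pencil is homogeneous of degree d in X and Y, so X^e comes only from r = d - e,
    with binomial factor times r! equal to d! / e!. *)
Lemma coef_rank1_average (e : nat) : (e <= d)%N ->
  (e`!)%:R * (rank1_average a x d (@shifted_det R d) 0)`_e =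
  (d`!)%:R * (\sum_i x i) ^+ e * (shifted_det (weighted_gram a x))`_e.
Proof.
move=> ed; rewrite rank1_average_shifted_det coef_sum.
rewrite (bigD1 (inord (d - e))) //= [X in _ * (_ + X)]big1 => [|r rne]; rewrite ?addr0 coefZ.
  rewrite inordK ?ltnS ?leq_subr // subKn // pencil_det_eigenvalues ?weighted_gram_sym //.
  have [_ [_ _ _ _ sz]] := eigenvalues_spectral weighted_gram_sym.
  rewrite (@coef_homogenized _ _ _ e) ?sz ?subnK // -shifted_det_eigenvalues ?weighted_gram_sym //.
  rewrite coefZ coefXn eqxx mulr1 !mulrA -natrM; congr (_%:R * _ * _).
  by rewrite mulnA [(_ * 'C(_, _))%N]mulnC -mulnA bin_sub // [(e`! * _)%N]mulnC
    -(bin_fact ed) [(e`! * _)%N]mulnC.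
rewrite pencil_det_eigenvalues ?weighted_gram_sym //.
have [_ [_ _ _ _ sz]] := eigenvalues_spectral weighted_gram_sym.
have rd : (r <= d)%N by rewrite -ltnS.
rewrite (@coef_homogenized _ _ _ (d - r)) ?sz ?subnKC // coefZ coefXn.
case: eqP => [er|]; rewrite ?mulr0 //; case/eqP: rne; apply/val_inj.
by rewrite /= inordK ?er ?subKn // ltnS leq_subr.
Qed.
End SampledCoefficients.

(** * Coefficient inequalities and the factor d *)

Section ShiftedProducts.
Variable R : realType.
Implicit Types s : seq R.

Let q s : {poly R} := \prod_(e <- s) ('X + e%:P).

Lemma coef_prod_shift_cons e s i :
  (q (e :: s))`_i = (if i == 0%N then 0 else (q s)`_i.-1) + e * (q s)`_i.
Proof. by rewrite /q big_cons mulrDl coefD coefXM coefCM. Qed.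

Lemma coef_prod_shift_ge0 s i : (forall e, e \in s -> 0 <= e) -> 0 <= (q s)`_i.
Proof.
elim: s i => [|e s IHs] i s0; first by rewrite /q big_nil coef1 ler0n.
have q0 j : 0 <= (q s)`_j by apply: IHs => y ys; rewrite s0 // in_cons ys orbT.
have e0 : 0 <= e := s0 _ (mem_head _ _).
by rewrite coef_prod_shift_cons addr_ge0 ?mulr_ge0 //; case: ifP.
Qed.

Lemma prod_shift_log_deriv s (lambda : R) : 0 < lambda -> (forall e, e \in s -> 0 <= e) ->
  (q s)^`().[lambda] = (q s).[lambda] * \sum_(e <- s) (e + lambda)^-1.
Proof.
move=> l0; rewrite /q; elim: s => [|e s IHs] s0.
  by rewrite !big_nil -polyC1 derivC horner0 mulr0.
rewrite !big_cons derivM derivD derivX derivC addr0 mul1r hornerD !hornerM.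
rewrite !hornerD !hornerX !hornerC.
rewrite IHs; last first.
  by move=> y ys; rewrite s0 // in_cons ys orbT.
have e0 : 0 <= e := s0 _ (mem_head _ _).
by field; rewrite gt_eqF // ltr_wpDl.
Qed.

(** Dividing the product q_0 of the list by e + lambda gives at most the product of the other
    entries, and these products add up to q_1. *)
Lemma prod_shift_coef_bound0 s (lambda : R) :
  0 < lambda -> (forall e, e \in s -> 0 <= e) ->
  (q s)`_0 * \sum_(e <- s) (e + lambda)^-1 <= (q s)`_1.
Proof.
move=> l0; elim: s => [|e s IHs] s0; first by rewrite big_nil mulr0 /q big_nil coef1.
have s0' : forall y, y \in s -> 0 <= y by move=> y ys; rewrite s0 // in_cons ys orbT.
have e0 : 0 <= e := s0 _ (mem_head _ _).
have el : 0 < e + lambda by rewrite ltr_wpDl.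
rewrite big_cons !coef_prod_shift_cons /= add0r mulrDr lerD //; last first.
  by rewrite -mulrA ler_wpM2l // IHs.
by rewrite mulrAC ler_piMl ?coef_prod_shift_ge0 // ler_pdivrMr // mul1r lerDl ltW.
Qed.

(** For q = (X + e) r, (q_0 + kappa lambda q_1) / (e + lambda) <= r_0 + kappa lambda r_1 because
    kappa <= 1. The cofactors r add up to q', whose first coefficients are q_1 and 2 q_2. The proof
    organizes this as an induction on the list. *)
Lemma prod_shift_coef_bound s (lambda kappa : R) :
  0 < lambda -> 0 <= kappa <= 1 -> (forall e, e \in s -> 0 <= e) ->
  ((q s)`_0 + kappa * lambda * (q s)`_1) * \sum_(e <- s) (e + lambda)^-1
  <= (q s)`_1 + 2 * kappa * lambda * (q s)`_2.
Proof.
move=> l0 /andP [k0 k1]; elim: s => [|e s IHs] s0.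
  by rewrite big_nil mulr0 /q big_nil !coef1 mulr0 addr0.
have s0' : forall y, y \in s -> 0 <= y by move=> y ys; rewrite s0 // in_cons ys orbT.
have e0 : 0 <= e := s0 _ (mem_head _ _).
have el : 0 < e + lambda by rewrite ltr_wpDl.
have h0 := prod_shift_coef_bound0 l0 s0'; have h1 := IHs s0'.
rewrite big_cons !coef_prod_shift_cons /= add0r.
have q0 := @coef_prod_shift_ge0 s 0%N s0'; have q1 := @coef_prod_shift_ge0 s 1%N s0'.
set S := \sum_(j <- s) _ in h0 h1 *.
move: (q s)`_0 (q s)`_1 (q s)`_2 h0 h1 q0 q1 => q_0 q_1 q_2 h0 h1 q0 q1.
pose r := (e + lambda)^-1.
have r0 : 0 <= r by rewrite invr_ge0 ltW.
have er : r * e = 1 - r * lambda by rewrite /r; field; rewrite gt_eqF.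
have rl : 0 <= r * lambda by rewrite mulr_ge0 // ltW.
have rl1 : r * lambda <= 1 by rewrite -subr_ge0 -er mulr_ge0.
have kl0 : 0 <= kappa * lambda by rewrite mulr_ge0 // ltW.
have A1 := ler_wpM2l e0 h1; have A2 := ler_wpM2l kl0 h0.
have A3 : 0 <= q_0 * ((1 - kappa) * (r * lambda)).
  by rewrite mulr_ge0 // mulr_ge0 // subr_ge0.
have A4 : 0 <= kappa * lambda * q_1 * (r * lambda) by rewrite mulr_ge0 // mulr_ge0.
rewrite -/r -subr_ge0.
(* The gap is e times the inequality for the tail, plus kappa lambda times [prod_shift_coef_bound0],
   plus a remainder handled by r e = 1 - r lambda. *)
have -> : q_0 + e * q_1 + 2 * kappa * lambda * (q_1 + e * q_2) -
    (e * q_0 + kappa * lambda * (q_0 + e * q_1)) * (r + S) =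
  (e * (q_1 + 2 * kappa * lambda * q_2) - e * ((q_0 + kappa * lambda * q_1) * S)) +
  (kappa * lambda * q_1 - kappa * lambda * (q_0 * S)) +
  (q_0 + kappa * lambda * q_1 - (r * e) * (q_0 + kappa * lambda * q_1)
     - r * kappa * lambda * q_0) by ring.
rewrite er.
have -> : q_0 + kappa * lambda * q_1 - (1 - r * lambda) * (q_0 + kappa * lambda * q_1)
     - r * kappa * lambda * q_0 = q_0 * ((1 - kappa) * (r * lambda)) +
     kappa * lambda * q_1 * (r * lambda) by ring.
by apply: addr_ge0; apply: addr_ge0; rewrite ?subr_ge0.
Qed.

(* Only the three lowest coefficients need the hypothesis: for the others
   [c lambda^i <= b i lambda^(i-1)] already follows from [z lambda <= b]. *)
Lemma horner_le_deriv (p : {poly R}) (lambda z b : R) :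
  (forall i, 0 <= p`_i) -> 0 < lambda -> z * lambda <= b -> 0 <= b ->
  z * (p`_0 + lambda * p`_1) <= b * p`_1 + lambda * b * p`_2 ->
  z * p.[lambda] <= b * p^`().[lambda].
Proof.
move=> p0 l0 zb b0 h; pose N := size p.
have step i : z * (p`_i.+2 * lambda ^+ i.+2) <= b * (p`_i.+2 * lambda ^+ i.+1).
  rewrite !(mulrCA _ p`_i.+2) ler_wpM2l // [lambda ^+ i.+2]exprS mulrA.
  by rewrite ler_wpM2r // exprn_ge0 // ltW.
have bp i j : 0 <= b * (p`_i * lambda ^+ j).
  by rewrite mulr_ge0 // mulr_ge0 // exprn_ge0 // ltW.
(* The ranges are padded so that splitting off three terms of p, and two of p', leaves tails of N
   terms that match index by index. *)
rewrite (@horner_coef_wide _ N.+3) -/N; last by rewrite !leqW.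
rewrite (@horner_coef_wide _ N.+2); last first.
  apply: leq_trans (_ : N <= _)%N; last by rewrite !leqW.
  by have [->|/lt_size_deriv/ltnW//] := eqVneq p 0; rewrite -polyC0 derivC size_poly0.
rewrite !big_ord_recl /= !coef_deriv /=.
have : z * (\sum_(i < N) p`_i.+3 * lambda ^+ i.+3) <=
       b * (\sum_(i < N) (p`_i.+3 *+ i.+3) * lambda ^+ i.+2).
  rewrite !mulr_sumr; apply: ler_sum => i _; apply: le_trans (step _) _.
  by rewrite mulrnAl mulrnAr mulrSr lerDr mulrn_wge0.
(* The term 2 p_2 lambda of p'(lambda) pays once for [h] and once for the degree 2 term of
   p(lambda). *)
have := step 0%N; rewrite /bump /= !expr0 !expr1 !mulr1n !mulr1 expr2 => s0 sN.
rewrite [\sum_(i < N) p^`()`_ _ * _](eq_bigr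
  (fun i : 'I_N => p`_i.+3 *+ i.+3 * lambda ^+ i.+2)); last first.
  by move=> i _; rewrite coef_deriv.
rewrite !add1n mulr2n.
set S1 := \sum_(i < N) _ in sN *; set S2 := \sum_(i < N) _ in sN *.
by move: sN s0 h; clearbody S1 S2; lra.
Qed.
End ShiftedProducts.

Lemma min_subset_le_inverse_trace (R : realType) (n d : nat) (a : 'I_n -> 'cV[R]_d)
    (lambda z : R) (x : 'I_n -> R) :
  (0 < d)%N -> 0 < lambda -> (forall i, 0 <= x i) -> \sum_i x i = d%:R ->
  0 <= z -> z * lambda <= d%:R ->
  (forall S : {set 'I_n}, #|S| = d ->
     z <= inverse_trace lambda (\sum_(i in S) a i *m (a i)^T)) ->
  z <= d%:R * inverse_trace lambda (weighted_gram a x).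
Proof.
move=> d0 l0 x0 xd z0 zl zmin.
(* Averaging over d-tuples scales coefficient e by (d! / e!) d^e, so with 1 / d the condition [C] on
   the average becomes the hypothesis of [horner_le_deriv] with b = d. *)
pose kappa : R := d%:R^-1.
have dR : 0 < d%:R :> R by rewrite ltr0n.
have k01 : 0 <= kappa <= 1.
  by rewrite invr_ge0 ler0n /= invf_le1 // ler1n.
pose C (p : {poly R}) := z * (p`_0 + kappa * lambda * p`_1) <=
  p`_1 + 2 * kappa * lambda * p`_2.
have eig_ge0 (M : 'M[R]_d) : psd M -> forall e, e \in eigenvalues M -> 0 <= e.
  by move=> psdM e /(nthP 0) [i _ <-]; exact: psd_eigenvalue_ge0.
have sumE (M : 'M[R]_d) : psd M ->
    inverse_trace lambda M = \sum_(e <- eigenvalues M) (e + lambda)^-1.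
  move=> psdM; have [symM _] := psdM.
  have [_ [_ _ _ _ sz]] := eigenvalues_spectral symM.
  have [_ _ ->] := psd_shift_spectral l0 psdM.
  by rewrite (big_nth 0) sz big_mkord.
have Cs (s : seq 'I_n) : size s = d ->
    C (shifted_det (0 + \sum_(i <- s) a i *m (a i)^T)).
  move=> sd; rewrite add0r; set M := \sum_(i <- s) _.
  have psdM : psd M.
    by rewrite /M; elim/big_ind: _; [exact: psd0|exact: psdD|move=> *; exact: psd_rank1].
  have [symM _] := psdM; rewrite /C shifted_det_eigenvalues //.
  have qge i := @coef_prod_shift_ge0 R (eigenvalues M) i (eig_ge0 M psdM).
  have kl0 : 0 <= kappa * lambda by rewrite mulr_ge0 ?(ltW l0) //; case/andP: k01.
  (* Distinct indices form an admissible set. A repeated index leaves the row space in the span of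
     fewer than d vectors, so p_0 = 0 and z lambda <= d suffices. *)
  have [us|nus] := boolP (uniq s).
    apply: le_trans (prod_shift_coef_bound l0 k01 (eig_ge0 M psdM)).
    rewrite mulrC; apply: ler_wpM2l; first by rewrite addr_ge0 // mulr_ge0.
    rewrite -sumE //.
    have -> : M = \sum_(i in [set i in s]) a i *m (a i)^T.
      by rewrite /M big_uniq //=; apply: eq_bigl => i; rewrite inE.
    by apply: zmin; rewrite cardsE (card_uniqP us).
  have -> : (\prod_(e <- eigenvalues M) ('X + e%:P))`_0 = 0.
    rewrite -shifted_det_eigenvalues // -horner_coef0 -[LHS]/(horner_eval 0 _) -det_map_mx.
    have -> : map_mx (horner_eval 0) ('X%:M + map_mx polyC M) = M.
      apply/matrixP => i j; rewrite !mxE /horner_eval hornerD hornerC hornerMn hornerX.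
      by rewrite mul0rn add0r.
    pose B : 'M[R]_(size (undup s), d) :=
      \matrix_(i, j) a (tnth (in_tuple (undup s)) i) j 0.
    have MB : (M <= B)%MS.
      rewrite /M big_seq; apply: summx_sub => i si.
      apply: submx_trans (submxMl _ _) _.
      have si' : i \in in_tuple (undup s) by rewrite /= mem_undup.
      have [k ik] := tnthP _ _ si'.
      have -> : (a i)^T = row k B by apply/rowP => j; rewrite !mxE -ik.
      exact: row_sub.
    apply/eqP; rewrite -[_ == 0]negbK -unitfE -unitmxE -row_free_unit -row_leq_rank -ltnNge.
    apply: leq_ltn_trans (mxrankS MB) _; apply: leq_ltn_trans (rank_leq_row _) _.
    by rewrite -sd ltn_size_undup.
  rewrite add0r; set q := _`_1 in qge *.
  have q1 : 0 <= q by exact: qge.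
  have -> : z * (kappa * lambda * q) = (z * lambda) * kappa * q by ring.
  rewrite -[leLHS]addr0; apply: lerD.
    by rewrite ler_piMl // ler_pdivrMr // mul1r.
  by rewrite mulr_ge0 // -mulrA mulr_ge0.
have : C (rank1_average a x d (@shifted_det R d) 0).
  apply: (rank1_average_cone (C := C)) => //.
  - by rewrite /C !coef0 !mulr0 addr0 mulr0.
  - rewrite /C => u v; rewrite !coefD => Cu Cv; lra.
  - rewrite /C => c u c0; rewrite !coefZ => Cu.
    have := ler_wpM2l c0 Cu; lra.
set Q := rank1_average a x d (@shifted_det R d) 0; rewrite /C.
set p := shifted_det (weighted_gram a x).
have psdA : psd (weighted_gram a x).
  by apply: psd_sum => i _; apply: psdZ => //; exact: psd_rank1.
have [symA _] := psdA.
have pE : p = \prod_(e <- eigenvalues (weighted_gram a x)) ('X + e%:P).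
  exact: shifted_det_eigenvalues.
have pge i : 0 <= p`_i by rewrite pE coef_prod_shift_ge0 //; exact: eig_ge0.
have Q0 : Q`_0 = (d`!)%:R * p`_0.
  by have := coef_rank1_average a x (leq0n d); rewrite mul1r expr0 mulr1.
have Q1 : Q`_1 = (d`!)%:R * d%:R * p`_1.
  by have := coef_rank1_average a x d0; rewrite mul1r expr1 xd.
have Q2 : 2 * Q`_2 = (d`!)%:R * d%:R ^+ 2 * p`_2.
  (* For d = 1 the index 2 exceeds the degree and both sides vanish. *)
  have [d1|d2] := ltnP 1 d; first by have := coef_rank1_average a x d1; rewrite xd.
  have big0 (N : 'M[R]_d) : (shifted_det N)`_2 = 0.
    by rewrite shifted_det_char_poly nth_default // size_char_poly.
  rewrite /p big0 mulr0 [Q`_2](_ : _ = 0) ?mulr0 //.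
  apply: (rank1_average_cone (C := fun u : {poly R} => u`_2 = 0)) => //.
  - by rewrite coef0.
  - by move=> u v u0 v0; rewrite coefD u0 v0 addr0.
  - by move=> c u _ u0; rewrite coefZ u0 mulr0.
move=> CQ.
have CA : z * (p`_0 + lambda * p`_1) <= d%:R * p`_1 + lambda * d%:R * p`_2.
  have f0 : 0 < (d`!)%:R :> R by rewrite ltr0n fact_gt0.
  rewrite -(ler_pM2l f0).
  have -> : (d`!)%:R * (z * (p`_0 + lambda * p`_1)) = z * (Q`_0 + kappa * lambda * Q`_1).
    by rewrite Q0 Q1 /kappa; field; rewrite gt_eqF.
  apply: le_trans CQ _.
  have -> : 2 * kappa * lambda * Q`_2 = kappa * lambda * (2 * Q`_2) by ring.
  rewrite Q1 Q2 le_eqVlt; apply/orP; left; apply/eqP.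
  by rewrite /kappa; field; rewrite gt_eqF.
have := horner_le_deriv pge l0 zl (ltW dR) CA.
(* The logarithmic derivative of p at lambda is f(A(x)); dividing by p(lambda) > 0 concludes. *)
rewrite pE prod_shift_log_deriv //; last exact: eig_ge0.
rewrite -sumE // mulrCA [leLHS]mulrC ler_pM2l // horner_prod big_seq.
apply: prodr_gt0 => e eA; rewrite hornerD hornerX hornerC ltr_pwDl //.
exact: eig_ge0 psdA _ eA.
Qed.

(** * Removing and adding elements *)

Lemma trace_rank1 (R : realType) (d : nat) (Y : 'M[R]_d) (a : 'cV[R]_d) :
  \tr (Y *m (a *m a^T)) = quad Y a.
Proof. by rewrite mulmxA mxtrace_mulC mulmxA trace_mx11. Qed.

Lemma sqnorm_sym (R : realType) (d : nat) (V : 'M[R]_d) (a : 'cV[R]_d) :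
  V^T = V -> sqnorm (V *m a) = quad (V *m V) a.
Proof. by move=> symV; rewrite /sqnorm trmx_mul symV /quad !mulmxA. Qed.

Lemma sqnormZ (R : realType) (d : nat) (c : R) (v : 'cV[R]_d) :
  sqnorm (c *: v) = c ^+ 2 * sqnorm v.
Proof.
by rewrite !sqnormE mulr_sumr; apply: eq_bigr => i _; rewrite mxE exprMn.
Qed.

Section RankOneUpdate.
Variables (R : realType) (d : nat) (lambda : R) (X : 'M[R]_d) (a : 'cV[R]_d).
Hypotheses (lambda_gt0 : 0 < lambda) (psdX : psd X).

Let W := invmx (X + lambda%:M).
Let V := invmx (X + a *m a^T + lambda%:M).
Let h := quad W a.

Let psdXa : psd (X + a *m a^T).
Proof. exact: psdD psdX (psd_rank1 a). Qed.

Let h1_gt0 : 0 < 1 + h.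
Proof. by have [_ pW] := invmx_shift_psd lambda_gt0 psdX; rewrite ltr_pwDl // pW. Qed.

(** Sherman-Morrison, checked by multiplication using K W K = h K for K = a a^T. *)
Lemma invmx_rank1_update : V = W - (1 + h)^-1 *: (W *m (a *m a^T) *m W).
Proof.
have Xu := shift_unitmx lambda_gt0 psdX; have Xau := shift_unitmx lambda_gt0 psdXa.
have XW : (X + lambda%:M) *m W = 1%:M by exact: mulmxV.
apply: (can_inj (mulKmx Xau)); rewrite [LHS]mulmxV // mulmxBr -scalemxAr.
have -> : X + a *m a^T + lambda%:M = (X + lambda%:M) + a *m a^T by rewrite addrAC.
have KWK : (a *m a^T) *m W *m (a *m a^T) = h *: (a *m a^T).
  rewrite !mulmxA -(mulmxA _ a^T) -(mulmxA a) [a^T *m W *m a]mx11_scalar.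
  by rewrite -/(quad W a) -/h mul_mx_scalar -scalemxAl.
move: (a *m a^T) KWK (X + lambda%:M) XW => K KWK M XW.
rewrite !mulmxDl !mulmxA XW mul1mx.
rewrite KWK -scalemxAl -[X in _ *: (X + _)]scale1r -scalerDl scalerA mulVf ?gt_eqF //.
by rewrite scale1r addrK.
Qed.

Lemma inverse_trace_rank1_update :
  inverse_trace lambda X - inverse_trace lambda (X + a *m a^T) =
  (1 + h)^-1 * sqnorm (W *m a).
Proof.
rewrite /inverse_trace -/V -/W invmx_rank1_update linearB /= opprB addrC subrK.
rewrite linearZ /= mxtrace_mulC mulmxA trace_rank1 sqnorm_sym //.
exact: invmx_shift_sym.
Qed.

(** The cost |W a|^2 / (1 + h) is at most (h / lambda) / (1 + h). *)
Lemma inverse_trace_drop :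
  inverse_trace lambda X <= inverse_trace lambda (X + a *m a^T) + lambda^-1.
Proof.
rewrite -lerBlDl inverse_trace_rank1_update ler_pdivrMl //.
apply: le_trans (sqnorm_invmx_shift_le a lambda_gt0 psdX) _.
by rewrite mulrC ler_wpM2r ?invr_ge0 ?(ltW lambda_gt0) // lerDr.
Qed.

Lemma leverage_lt1 : 0 < 1 - quad V a.
Proof.
suff -> : 1 - quad V a = (1 + h)^-1 by rewrite invr_gt0.
rewrite invmx_rank1_update -scaleNr quadD quadZ -/h.
have -> : quad (W *m (a *m a^T) *m W) a = h * h.
  rewrite /quad !mulmxA -(mulmxA _ a^T) -(mulmxA _ _ a) [a^T *m W *m a]mx11_scalar.
  by rewrite -/(quad W a) -/h mul_mx_scalar !mxE eqxx mulr1n.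
by field; rewrite gt_eqF.
Qed.

(** Both V a = W a / (1 + h) and 1 - a^T V a = 1 / (1 + h) hold. The removal cost is thus expressed
    through [V], the inverse for the larger set, common to all candidates, which makes averaging
    possible. *)
Lemma leverage_mul_drop :
  (1 - quad V a) * (inverse_trace lambda X - inverse_trace lambda (X + a *m a^T)) =
  sqnorm (V *m a).
Proof.
have Va : V *m a = (1 + h)^-1 *: (W *m a).
  rewrite invmx_rank1_update mulmxBl -scalemxAl.
  have -> : W *m (a *m a^T) *m W *m a = h *: (W *m a).
    rewrite !mulmxA -(mulmxA _ a^T) -(mulmxA _ _ a) [a^T *m W *m a]mx11_scalar.
    by rewrite -/(quad W a) -/h mul_mx_scalar.
  rewrite -[X in X - _]scale1r scalerA -scalerBl; congr (_ *: _).
  by field; rewrite gt_eqF.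
rewrite inverse_trace_rank1_update Va.
have -> : quad V a = (1 + h)^-1 * h.
  by rewrite /quad -mulmxA Va -scalemxAr mxE mulmxA.
rewrite sqnormZ.
by field; rewrite gt_eqF.
Qed.
End RankOneUpdate.

Definition subset_gram (R : realType) (n d : nat) (a : 'I_n -> 'cV[R]_d)
    (S : {set 'I_n}) : 'M[R]_d := \sum_(i in S) a i *m (a i)^T.

Section SubsetBounds.
Variables (R : realType) (n d : nat) (a : 'I_n -> 'cV[R]_d) (lambda : R).
Hypothesis lambda_gt0 : 0 < lambda.
Implicit Types S : {set 'I_n}.

Let f S := inverse_trace lambda (subset_gram a S).

Lemma subset_gram_psd S : psd (subset_gram a S).
Proof. by apply: psd_sum => i _; exact: psd_rank1. Qed.

Lemma subset_gramD1 S i : i \in S ->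
  subset_gram a S = subset_gram a (S :\ i) + a i *m (a i)^T.
Proof.
move=> iS; rewrite /subset_gram (bigD1 i) //= addrC; congr (_ + _).
by apply: eq_bigl => j; rewrite !inE andbC.
Qed.

(* Averaging over the removed element, weighted by one minus its leverage. *)
Lemma exists_cheap_removal S : (d < #|S|)%N ->
  exists2 i, i \in S &
    (#|S| - d)%:R * f (S :\ i) <= (#|S| - d).+1%:R * f S.
Proof.
move=> dS; pose X := subset_gram a S; pose V := invmx (X + lambda%:M).
have psdX : psd X by exact: subset_gram_psd.
have Xu := shift_unitmx lambda_gt0 psdX.
have symV : V^T = V by exact: invmx_shift_sym.
pose w i := 1 - quad V (a i); pose t : R := (#|S| - d)%:R.
have drop i : i \in S -> 0 < w i /\ w i * (f (S :\ i) - f S) = sqnorm (V *m a i).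
  move=> iS; have psdXi := subset_gram_psd (S :\ i).
  have := leverage_lt1 (a i) lambda_gt0 psdXi.
  by have := leverage_mul_drop (a i) lambda_gt0 psdXi; rewrite -subset_gramD1.
have VX : V *m X = 1%:M - lambda *: V.
  have -> : X = (X + lambda%:M) - lambda%:M by rewrite addrK.
  by rewrite mulmxBr mulVmx // mul_mx_scalar.
have fV : f S = \tr V by [].
(* The leverages sum to tr (V X) = d - lambda tr V <= d. *)
have sumw : t <= \sum_(i in S) w i.
  rewrite sumrB sumr_const -/(#|S|%:R) /t natrB ?(ltnW dS) // lerD2l lerN2.
  have -> : \sum_(i in S) quad V (a i) = \tr (V *m X).
    rewrite /X /subset_gram mulmx_sumr linear_sum; apply: eq_bigr => i _ /=.
    by rewrite trace_rank1.
  rewrite VX linearB /= mxtrace1 linearZ /= gerBl mulr_ge0 ?(ltW lambda_gt0) //.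
  by rewrite -fV inverse_trace_ge0.
(* The sum is tr (V^2 X) = tr V - lambda tr (V^2). *)
have sumsq : \sum_(i in S) sqnorm (V *m a i) <= f S.
  have -> : \sum_(i in S) sqnorm (V *m a i) = \tr (V *m V *m X).
    rewrite /X /subset_gram mulmx_sumr linear_sum; apply: eq_bigr => i _ /=.
    by rewrite trace_rank1 sqnorm_sym.
  rewrite -mulmxA VX mulmxBr mulmx1 linearB /= -fV gerBl -scalemxAr linearZ /=.
  rewrite mulr_ge0 ?(ltW lambda_gt0) //.
  have := trace_conj_ge0 V (psd_scalar d (@ler01 R)).
  by rewrite mulmx1 symV.
have f0 : 0 <= f S by exact: inverse_trace_ge0.
have t0 : 0 < t by rewrite ltr0n subn_gt0.
(* Otherwise the strict reverse inequalities, summed over the nonempty [S], contradict [sumw] and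
   [sumsq]. *)
have [i iS it] : exists2 i, i \in S & t * sqnorm (V *m a i) <= f S * w i.
  apply: contrapT => no.
  have lt i : i \in S -> f S * w i < t * sqnorm (V *m a i).
    by move=> iS; rewrite ltNge; apply/negP => le; apply: no; exists i.
  have /card_gt0P [i0 i0S] : (0 < #|S|)%N by exact: leq_ltn_trans dS.
  have : f S * \sum_(i in S) w i < t * \sum_(i in S) sqnorm (V *m a i).
    rewrite !mulr_sumr (bigD1 i0) // [ltRHS](bigD1 i0) //= ltr_leD ?lt //.
    by apply: ler_sum => i /andP [iS _]; rewrite ltW ?lt.
  apply/negP; rewrite -leNgt; apply: (le_trans (ler_wpM2l (ltW t0) sumsq)).
  by rewrite mulrC ler_wpM2l.
exists i => //; have [wi] := drop i iS; rewrite -/t => dropi.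
move: it; rewrite -dropi mulrCA mulrC ler_pM2r // => it.
by rewrite -[_.+1]addn1 natrD -/t; lra.
Qed.

(** The factors (t - d + 1) / (t - d) for t from n down to n - j + 1 telescope; the result is
    cross-multiplied. *)
Lemma exists_subset_removal j : (j + d <= n)%N ->
  exists2 S : {set 'I_n}, #|S| = (n - j)%N &
    (n - j - d).+1%:R * f S <= (n - d).+1%:R * f [set: 'I_n]%SET.
Proof.
elim: j => [|j IHj] jd; first by exists [set: 'I_n]%SET; rewrite ?cardsT ?card_ord ?subn0.
have [|S cS le] := IHj; first by rewrite ltnW.
have [|i iS lei] := @exists_cheap_removal S; first by rewrite cS; lia.
exists (S :\ i); first by move: (cardsD1 i S); rewrite iS cS; lia.
apply: le_trans le; rewrite cS in lei.
by have -> : (n - j.+1 - d).+1 = (n - j - d)%N by lia.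
Qed.

(** Averaged removal reaches size d with factor n - d + 1; from there each element costs at most 1 /
    lambda. *)
Lemma exists_subset_drop j : (j <= d)%N -> (d <= n)%N ->
  exists2 S : {set 'I_n}, #|S| = (d - j)%N &
    f S <= (n - d).+1%:R * f [set: 'I_n]%SET + j%:R / lambda.
Proof.
move=> + dn; elim: j => [|j IHj] jd.
  have [|S cS le] := @exists_subset_removal (n - d); first by rewrite subnK.
  exists S; first by rewrite cS; lia.
  by move: le; rewrite mul0r addr0 (_ : (n - (n - d) - d)%N = 0%N) ?mul1r //; lia.
have [|S cS le] := IHj; first exact: ltnW.
have /card_gt0P [i iS] : (0 < #|S|)%N by rewrite cS subn_gt0.
exists (S :\ i); first by move: (cardsD1 i S); rewrite iS cS; lia.
have := inverse_trace_drop (a i) lambda_gt0 (subset_gram_psd (S :\ i)).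
rewrite -subset_gramD1 // -/(f S) -/(f (S :\ i)) => le'.
by rewrite -natr1 mulrDl mul1r; lra.
Qed.

Lemma inverse_trace_rank1_le (v : 'cV[R]_d) :
  inverse_trace lambda (v *m v^T) <= (d%:R - 1) / lambda + (sqnorm v + lambda)^-1.
Proof.
have := inverse_trace_rank1_update v lambda_gt0 (psd0 R d).
have iE : invmx (0 + lambda%:M : 'M[R]_d) = (lambda^-1)%:M.
  by rewrite add0r invmx_scalar.
rewrite /inverse_trace iE !add0r mxtrace_scalar mul_scalar_mx sqnormZ quad_scalar.
rewrite -/(inverse_trace lambda (v *m v^T)) => /eqP; rewrite subr_eq addrC -subr_eq => /eqP <-.
have v0 := sqnorm_ge0 v; rewrite le_eqVlt; apply/orP; left; apply/eqP.
rewrite -[_ *+ d]mulr_natl; field.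
by rewrite !gt_eqF // ?ltr_wpDl // ltr_wpDr.
Qed.

(** Any k - 1 further indices will do, since adding rank-one terms only lowers the trace. *)
Lemma exists_subset_with_element (k : nat) (i : 'I_n) : (0 < k <= n)%N ->
  exists2 S : {set 'I_n}, #|S| = k & f S <= (d%:R - 1) / lambda + (sqnorm (a i) + lambda)^-1.
Proof.
move=> /andP [k0 kn]; pose T := [set x in take k.-1 (enum (~: [set i])%SET)].
have cT : #|T| = k.-1.
  rewrite cardsE (card_uniqP _) ?take_uniq ?enum_uniq // size_takel // -cardE.
  by rewrite cardsC1 card_ord; lia.
have iT : i \notin T.
  by rewrite inE; apply/negP => /mem_take; rewrite mem_enum !inE eqxx.
exists (i |: T); first by rewrite cardsU1 iT cT; lia.
rewrite /f (@subset_gramD1 _ i) ?setU11 // setU1K // addrC.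
apply: le_trans (inverse_trace_rank1_le (a i)).
by apply: inverse_trace_psdD => //; [exact: psd_rank1|exact: subset_gram_psd].
Qed.
End SubsetBounds.

(** * Attainment of the relaxation *)

Lemma psd_le_trace (R : realType) (d : nat) (F : 'M[R]_d) :
  psd F -> psd ((\tr F)%:M - F).
Proof.
move=> psdF; have [symF _] := psdF.
have [U [UU UU' Feq _ _]] := eigenvalues_spectral symF.
split=> [|v]; first by rewrite linearB /= symF tr_scalar_mx.
rewrite -/(quad _ v) -scaleN1r quadD quadZ quad_scalar mulN1r subr_ge0.
rewrite [in quad F _]Feq quad_spectral -(sqnorm_orth v UU') sqnormE mulr_sumr.
apply: ler_sum => i _; rewrite mxE ler_wpM2r ?sqr_ge0 // trace_eigenvalues //.
by rewrite (bigD1 i) //= lerDl sumr_ge0 // => j _; exact: psd_eigenvalue_ge0.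
Qed.

Lemma weighted_gram_psd (R : realType) (n d : nat) (a : 'I_n -> 'cV[R]_d) (x : 'I_n -> R) :
  (forall i, 0 <= x i) -> psd (weighted_gram a x).
Proof. by move=> x0; apply: psd_sum => i _; apply: psdZ => //; exact: psd_rank1. Qed.

Section Attainment.
Variables (R : realType) (n d m : nat) (a : 'I_n -> 'cV[R]_d) (lambda : R).
Hypotheses (md : (m <= d)%N) (lambda_gt0 : 0 < lambda).

Let G := \sum_i a i *m (a i)^T.
Let L := \tr G.

Let L_ge0 : 0 <= L.
Proof.
rewrite /L /G linear_sum sumr_ge0 // => i _ /=.
by rewrite mxtrace_mulC trace_mx11 -/(sqnorm _) sqnorm_ge0.
Qed.

(** A(x) + delta (L + 1) I - A(y) is the Gram sum with weights x_i - y_i + delta, plus delta (L I -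
    G), plus delta I, all in the cone. The 1 in L + 1 keeps the shift positive when every a_i is
    0. *)
Lemma conv_Gamma_weighted_gram_lipschitz (x y : 'I_n -> R) (delta : R) :
  (forall i, 0 <= x i) -> (forall i, 0 <= y i) -> 0 < delta ->
  (forall i, `|x i - y i| <= delta) ->
  conv_Gamma m lambda (weighted_gram a x) <=
  conv_Gamma m lambda (weighted_gram a y) + d%:R * (delta * (L + 1)) / lambda ^+ 2.
Proof.
move=> x0 y0 delta0 xy.
have dL0 : 0 < delta * (L + 1) by rewrite mulr_gt0 // ltr_wpDl.
have psdx := weighted_gram_psd a x0; have psdy := weighted_gram_psd a y0.
apply: le_trans (conv_Gamma_scalar md lambda_gt0 psdx dL0) _; rewrite lerD2r.
pose F := weighted_gram a x + (delta * (L + 1))%:M - weighted_gram a y.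
have -> : weighted_gram a x + (delta * (L + 1))%:M = weighted_gram a y + F.
  by rewrite [RHS]addrC subrK.
apply: conv_Gamma_psdD => //.
have -> : F = weighted_gram a (fun i => x i - y i + delta) +
    (delta *: (L%:M - G) + delta%:M).
  have -> : weighted_gram a (fun i => x i - y i + delta) =
      weighted_gram a x - weighted_gram a y + delta *: G.
    rewrite /weighted_gram /G scaler_sumr -sumrB -big_split; apply: eq_bigr => i _ /=.
    by rewrite scalerDl scalerBl.
  rewrite scalerBr scale_scalar_mx addrA addrACA subrr addr0.
  rewrite /F mulrDr mulr1 raddfD /= -!addrA; congr (_ + _).
  by rewrite [RHS]addrC -!addrA.
apply: psdD; first by apply: weighted_gram_psd => i; have := xy i; rewrite ler_norml; lra.
apply: psdD; last exact: psd_scalar (ltW delta0).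
apply: psdZ; first exact: ltW.
apply: psd_le_trace; apply: psd_sum => i _; exact: psd_rank1.
Qed.

(** Extreme value theorem: the feasible set is compact, contains the constant vector k / n, and the
    objective is Lipschitz on it. *)
Lemma exists_min_conv_Gamma (k : nat) : (k <= n)%N ->
  let K := [set x : 'rV[R]_n | (forall i, 0 <= x 0 i <= 1) /\ \sum_i x 0 i = k%:R] in
  exists2 x, K x & forall y, K y ->
    conv_Gamma m lambda (weighted_gram a (x 0)) <=
    conv_Gamma m lambda (weighted_gram a (y 0)).
Proof.
move=> kn K; pose N (x : 'rV[R]_n) := conv_Gamma m lambda (weighted_gram a (x 0)).
have K0 : K !=set0.
  exists (const_mx (k%:R / n%:R)); split=> [i|].
    rewrite mxE divr_ge0 ?ler0n //=.
    by rewrite ler_pdivrMr ?mul1r ?ler_nat // ltr0n (leq_ltn_trans _ (ltn_ord i)).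
  rewrite (eq_bigr (fun=> k%:R / n%:R)); last by move=> i _; rewrite mxE.
  rewrite sumr_const card_ord -[LHS]mulr_natr; have [n0|n0] := eqVneq n 0%N.
    by move: kn; rewrite n0 leqn0 => /eqP ->; rewrite mulr0.
  by rewrite divfK // pnatr_eq0.
have cK : compact K.
  have -> : K = [set x : 'rV[R]_n | forall i, x 0 i \in `[0, 1]] `&`
      (fun x : 'rV[R]_n => \sum_i x 0 i) @^-1` [set y | y = k%:R].
    by apply/seteqP; split=> x [x01 xk]; split=> // i; have := x01 i; rewrite in_itv.
  apply: compact_closedI.
    exact: (@rV_compact R n (fun=> `[0, 1]%classic) (fun=> @segment_compact R 0 1)).
  apply: preimage_closed; last exact: closed_eq.
  move=> x _; have : continuous (fun x : 'rV[R]_n => \sum_i x 0 i); last exact.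
  by apply: continuous_big => [|i _]; [exact: add_continuous|exact: coord_continuous].
have cN : {within K, continuous N}.
  apply/subspace_continuousP => x Kx; apply/cvgrPdist_le => e e0.
  (* [c - 1] is the Lipschitz constant; the added 1 keeps [c] positive when d = 0. *)
  pose c := d%:R * (L + 1) / lambda ^+ 2 + 1.
  have c0 : 0 < c.
    by rewrite ltr_wpDl // divr_ge0 ?exprn_ge0 ?(ltW lambda_gt0) // mulr_ge0 ?ler0n // addr_ge0.
  have delta0 : 0 < e / c by rewrite divr_gt0.
  have le_e : d%:R * (e / c * (L + 1)) / lambda ^+ 2 <= e.
    rewrite [leLHS](_ : _ = e * ((c - 1) / c)); last first.
      have -> : c - 1 = d%:R * (L + 1) / lambda ^+ 2 by rewrite /c addrK.
      by clearbody c; field; rewrite !gt_eqF.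
    by rewrite ler_piMr ?(ltW e0) // ler_pdivrMr // mul1r gerBl.
  near=> y.
  have [Ky xy] : K y /\ forall i, `|x 0 i - y 0 i| <= e / c.
    split; first by near: y; exact: withinT.
    move=> i; have : ball x (e / c) y; last by case=> _ /(_ 0 i) /ltW.
    by near: y; apply: cvg_within; exact: nbhsx_ballx.
  have pos (u : 'rV[R]_n) : K u -> forall i, 0 <= u 0 i.
    by move=> [u01 _] i; case/andP: (u01 i).
  have yx i : `|y 0 i - x 0 i| <= e / c by rewrite distrC.
  have h1 : N x <= N y + e.
    apply: le_trans (_ : N y + _ <= _); last by rewrite lerD2l; exact: le_e.
    exact: conv_Gamma_weighted_gram_lipschitz (pos _ Kx) (pos _ Ky) delta0 xy.
  have h2 : N y <= N x + e.
    apply: le_trans (_ : N x + _ <= _); last by rewrite lerD2l; exact: le_e.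
    exact: conv_Gamma_weighted_gram_lipschitz (pos _ Ky) (pos _ Kx) delta0 yx.
  by rewrite ler_norml lerBlDl h1 andbT lerBrDl -lerBrDr opprK.
have [x Kx xmin] := EVT_min_rV K0 cK cN.
exists x; first exact: set_mem.
by move=> y Ky; apply: xmin; exact: mem_set.
Unshelve. all: end_near.
Qed.
End Attainment.

(** * Rank of Gram sums and the three ratio bounds *)

(** The |S| conditions a_j^T v = 0 make the form vanish at the vector of [eigenvalue_witness], so
    the eigenvalue at index |S|, counted from 0, is at most 0. *)
Lemma subset_gram_low_rank (R : realType) (n d : nat) (a : 'I_n -> 'cV[R]_d)
    (S : {set 'I_n}) (i : nat) : (#|S| <= i < d)%N ->
  (eigenvalues (subset_gram a S))`_i = 0.
Proof.
move=> /andP [Si id]; have psdS := subset_gram_psd a S; have [symS _] := psdS.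
apply/eqP; rewrite eq_le psd_eigenvalue_ge0 // andbT.
have Sd : (#|S| < d)%N by exact: leq_ltn_trans id.
pose B : 'M[R]_(#|S|, d) := \matrix_(r, c) a (enum_val r) c 0.
have [U [_ _ _ mono _]] := eigenvalues_spectral symS.
apply: le_trans (mono #|S| i _) _; first by rewrite Si.
have [v [v0 Bv le]] := eigenvalue_witness B symS Sd.
suff q0 : quad (subset_gram a S) v = 0.
  by move: le; rewrite q0 pmulr_lle0 // sqnorm_gt0.
rewrite /quad -mulmxA /subset_gram mulmx_suml big1 ?mulmx0 ?mxE // => j jS.
rewrite -mulmxA; suff -> : (a j)^T *m v = 0 by rewrite mulmx0.
have -> : (a j)^T = row (enum_rank_in jS j) B.
  by apply/rowP => c; rewrite !mxE enum_rankK_in.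
by rewrite -row_mul Bv row0.
Qed.

Theorem corollary2 (R : realType) (d n k : nat)
    (d_gt0 : (0 < d)%N) (k_gt0 : (0 < k)%N) (le_dn : (d <= n)%N)
    (le_kn : (k <= n)%N) (a : 'I_n -> 'cV[R]_d) (lambda : R)
    (lambda_gt0 : 0 < lambda) :
  exists z nu : R,
    [/\ is_min (z_values k a lambda) z,
        is_min (nu_values k a lambda) nu,
        (k < d)%N ->
          1 <= z / nu <= Num.min ((d%:R - 1) / (d%:R - k%:R))
                                 (n%:R - k%:R + 1),
        k = d ->
          1 <= z / nu <= Num.min d%:R (n%:R - d%:R + 1) &
        (d < k)%N ->
          1 <= z / nu <= (n%:R - d%:R + 1) / (k%:R - d%:R + 1)].
Proof.
pose f (S : {set 'I_n}) := inverse_trace lambda (subset_gram a S).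
set m := minn k d; have md : (m <= d)%N by exact: geq_minr.
have [i0 i0max] : exists i : 'I_n, forall j, sqnorm (a j) <= sqnorm (a i).
  pose j0 : 'I_n := Ordinal (leq_trans d_gt0 le_dn).
  have [i _ imax] := @arg_maxP _ _ _ j0 xpredT (fun j => sqnorm (a j)) isT.
  by exists i => j; exact: imax.
have kn0 : (0 < k <= n)%N by rewrite k_gt0.
have [S0 cS0 _] := exists_subset_with_element a lambda_gt0 i0 kn0.
have [Sz /eqP cSz zmin] : exists2 S : {set 'I_n}, #|S| == k &
    forall T : {set 'I_n}, #|T| = k -> f S <= f T.
  have cS0' : #|S0| == k by rewrite cS0.
  have [S cS Smin] := @arg_minP _ _ _ S0 (fun S : {set 'I_n} => #|S| == k) f cS0'.
  by exists S => // T /eqP; exact: Smin.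
have [x [x01 xk] xmin] := exists_min_conv_Gamma a md lambda_gt0 le_kn.
have x0 i : 0 <= x 0 i by case/andP: (x01 i).
pose X := weighted_gram a (x 0); have psdX : psd X by exact: weighted_gram_psd.
pose nu := conv_Gamma m lambda X + (d%:R - m%:R) / lambda.
exists (f Sz), nu.
have z_gt0 : 0 < f Sz by apply: inverse_trace_gt0 => //; exact: subset_gram_psd.
have f_le_nu : f [set: 'I_n]%SET <= nu.
  apply: le_trans (inverse_trace_le_conv_Gamma md lambda_gt0 psdX).
  (* Since x_i <= 1, A_[n] exceeds A(x) by a Gram sum with nonnegative weights. *)
  rewrite /f; have -> : subset_gram a [set: 'I_n]%SET = X + weighted_gram a (fun i => 1 - x 0 i).
    rewrite /X /weighted_gram -big_split /subset_gram.
    apply: eq_big => [i|i _]; first by rewrite inE.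
    by rewrite /= -scalerDl addrC subrK scale1r.
  apply: inverse_trace_psdD => //; apply: weighted_gram_psd => i.
  by rewrite subr_ge0; case/andP: (x01 i).
have nu_gt0 : 0 < nu.
  apply: lt_le_trans f_le_nu; apply: inverse_trace_gt0 => //; exact: subset_gram_psd.
have nu_le_z : nu <= f Sz.
  (* The indicator of an optimal set is feasible for the relaxation. *)
  pose y : 'rV[R]_n := \row_i (i \in Sz)%:R.
  have yS : weighted_gram a (y 0) = subset_gram a Sz.
    rewrite /subset_gram big_mkcond; apply: eq_bigr => i _; rewrite mxE.
    by case: (i \in Sz); rewrite ?scale1r ?scale0r.
  rewrite /f (@inverse_trace_low_rank _ _ m) //; last 2 first.
  - exact: subset_gram_psd.
  - move=> i /andP [mi id]; apply: subset_gram_low_rank; rewrite id andbT cSz.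
    by move: mi; rewrite /m geq_min [(d <= i)%N]leqNgt id orbF.
  rewrite lerD2r; apply: le_trans (xmin y _) _.
    split=> [i|]; first by rewrite mxE; case: (i \in Sz); rewrite ?lexx ?ler01.
    rewrite (eq_bigr (fun i => if i \in Sz then 1 else 0)); last first.
      by move=> i _; rewrite mxE; case: (i \in Sz).
    by rewrite -big_mkcond sumr_const cSz.
  rewrite yS; apply: conv_Gamma_le_Gamma => //; exact: subset_gram_psd.
have ratio_ge1 : 1 <= f Sz / nu by rewrite ler_pdivlMr // mul1r.
(* Kept in product form to serve both k = d, where the left factor is 1, and k > d. *)
have big_k : (d <= k)%N -> (k - d).+1%:R * f Sz <= (n - d).+1%:R * nu.
  move=> dk; have [|S cS] := @exists_subset_removal _ _ _ a _ lambda_gt0 (n - k).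
    by lia.
  have -> : (n - (n - k) - d)%N = (k - d)%N by lia.
  move=> le; apply: le_trans (_ : (k - d).+1%:R * f S <= _).
    by rewrite ler_wpM2l ?ler0n // zmin // cS subKn.
  by apply: le_trans le _; rewrite ler_wpM2l ?ler0n.
split.
- split=> [|_ [S cS <-]]; first by exists Sz.
  exact: zmin.
- split; first by exists x.
  by move=> _ [y Ky <-]; rewrite lerD2r; exact: xmin.
- move=> kd; rewrite ratio_ge1 /= le_min.
  have mk : m = k by rewrite /m; apply/minn_idPl; exact: ltnW.
  have dk_gt0 : 0 < d%:R - k%:R :> R by rewrite subr_gt0 ltr_nat.
  apply/andP; split.
    rewrite ler_pdivrMr // mulrAC ler_pdivlMr //.
    (* With this [u] the tangent touches t |-> 1 / (t + lambda) at t = max |a_i|^2. *)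
    pose u := (sqnorm (a i0) + lambda)^-1.
    have q0 := sqnorm_ge0 (a i0).
    have ql : 0 < sqnorm (a i0) + lambda by rewrite ltr_wpDl.
    have u0 : 0 < u by rewrite invr_gt0.
    have [S cS fS] := exists_subset_with_element a lambda_gt0 i0 kn0.
    have zle : f Sz <= (d%:R - 1) / lambda + u by apply: le_trans fS; exact: zmin.
    have trX : \tr X <= k%:R * sqnorm (a i0).
      rewrite -xk mulr_suml /X /weighted_gram linear_sum; apply: ler_sum => i _ /=.
      rewrite mxtraceZ mxtrace_mulC trace_mx11; rewrite -/(sqnorm (a i)).
      by apply: ler_wpM2l; [exact: x0 | exact: i0max].
    have nuge : (d%:R - k%:R) / lambda + k%:R * u <= nu.
      rewrite /nu mk addrC lerD2r -mk.
      apply: le_trans (conv_Gamma_tangent md lambda_gt0 u psdX); rewrite mk.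
      have := ler_wpM2l (sqr_ge0 u) trX.
      have uq : u * sqnorm (a i0) = 1 - u * lambda by rewrite /u; field; rewrite gt_eqF.
      have -> : u ^+ 2 * (k%:R * sqnorm (a i0)) = k%:R * u * (u * sqnorm (a i0)) by ring.
      by rewrite uq; lra.
    have k1 : 1 <= k%:R :> R by rewrite ler1n.
    apply: le_trans (ler_wpM2r (ltW dk_gt0) zle) _.
    apply: le_trans (ler_wpM2l (_ : 0 <= d%:R - 1) nuge); last by rewrite subr_ge0 ler1n.
    rewrite -subr_ge0.
    have -> : (d%:R - 1) * ((d%:R - k%:R) / lambda + k%:R * u) -
        ((d%:R - 1) / lambda + u) * (d%:R - k%:R) =
        u * (d%:R * (k%:R - 1)) by ring.
    by rewrite mulr_ge0 ?(ltW u0) // mulr_ge0 ?ler0n // subr_ge0.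
  rewrite ler_pdivrMr //.
  have [|S cS le] := @exists_subset_drop _ _ _ a _ lambda_gt0 (d - k) _ le_dn.
    exact: leq_subr.
  have zle : f Sz <= f S by apply: zmin; rewrite cS subKn // ltnW.
  have lenu : (d - k)%:R / lambda <= nu.
    by rewrite natrB ?(ltnW kd) // /nu mk lerDr -mk conv_Gamma_ge0.
  (* Both f(A_[n]) and (d - k) / lambda are at most nu; since k < d, n - d + 2 is at most n - k +
     1. *)
  have : f Sz <= (n - d).+2%:R * nu.
    apply: (le_trans zle); apply: (le_trans le).
    rewrite -[(n - d).+2%:R]natr1 mulrDl mul1r lerD //.
    by rewrite ler_wpM2l ?ler0n.
  move=> /le_trans; apply; rewrite ler_wpM2r ?(ltW nu_gt0) //.
  by rewrite -natrB // natr1 ler_nat; lia.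
- move=> kd; rewrite ratio_ge1 /= le_min !ler_pdivrMr //; apply/andP; split.
    have mdE : m = d by rewrite /m kd minnn.
    apply: le_trans (_ : d%:R * inverse_trace lambda X <= _); last first.
      by rewrite ler_wpM2l ?ler0n // inverse_trace_le_conv_Gamma.
    (* The weights sum to k = d, and z lambda <= d since the shifted inverse has d eigenvalues of
       size at most 1 / lambda. *)
    apply: min_subset_le_inverse_trace => //; first by rewrite xk kd.
    + exact: ltW.
    + rewrite -ler_pdivlMr //; apply: inverse_trace_le => //; exact: subset_gram_psd.
    + by move=> S cS; apply: zmin; rewrite cS kd.
  have := big_k; rewrite kd => /(_ (leqnn _)); rewrite subnn mul1r.
  by rewrite -natr1 natrB.
- move=> dk; rewrite ratio_ge1 /=.
  rewrite ler_pdivrMr // mulrAC ler_pdivlMr; last first.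
    by rewrite ltr_wpDl // subr_ge0 ler_nat ltnW.
  have := big_k (ltnW dk); rewrite -!natr1 !natrB // ?(ltnW dk) //.
  by rewrite mulrC.
Qed.
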